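(* Let $K>1$. Suppose $f_\theta$ is a spectral density bounded away from zero with $\sum_{r\in\mathbb{Z}}|r^Kc_{f_\theta}(r)|<\infty$. Then $$\left\|F_n^*\Delta_n(f_\theta^{-1})D_{\infty,n}(f_\theta)\right\|_1\le A_1(f_\theta,f_\theta)$$ and, for some $0<\varepsilon<1$ (entering through the constant $C_{f_\theta,0}$), $$\left\|\Gamma_n(f_\theta)^{-1}-C_n(f_\theta^{-1})\right\|_1\le A_1(f_\theta,f_\theta)+\frac{C_{f_\theta,0}\,\rho_{n,K}(f_\theta)}{n^{K-1}}A_K(f_\theta,f_\theta).$$ Further, if $\{X_t\}$ is a time series with $\sup_t\|X_t\|_{\mathbb{E},2q}=\|X\|_{\mathbb{E},2q}<\infty$ for some $q>1$, then $$\|\mathcal{L}_n(\theta)-K_n(\theta)\|_{\mathbb{E},q}\le n^{-1}\left(A_1(f_\theta,f_\theta)+\frac{C_{f_\theta,0}\,\rho_{n,K}(f_\theta)}{n^{K-1}}A_K(f_\theta,f_\theta)\right)\|X\|_{\mathbb{E},2q}^2,$$ where $\mathcal{L}_n(\theta)=n^{-1}\underline{X}_n'\Gamma_n(f_\theta)^{-1}\underline{X}_n$ and $K_n(\theta)=n^{-1}\underline{X}_n'C_n(f_\theta^{-1})\underline{X}_n$.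
   Context: Time series are real-valued, $\underline{X}_n=(X_1,\ldots,X_n)'$. For a spectral density $f$ (positive, symmetric about $\pi$ on $[0,2\pi]$) with autocovariance $c_f$, $f(\omega)=\sum_rc_f(r)e^{ir\omega}$ and $\Gamma_n(f)_{s,t}=c_f(s-t)$ ($n\times n$). Canonical factorisation: $f=\sigma_f^2|\psi_f|^2=\sigma_f^2|\phi_f|^{-2}$ with $\phi_f(\omega)=\phi(\omega;f)=1-\sum_{j\ge1}\phi_j(f)e^{-ij\omega}$ and $\psi_f(\omega)=\phi_f(\omega)^{-1}=1+\sum_{j\ge1}\psi_j(f)e^{-ij\omega}$ (the causal, minimum phase AR$(\infty)$ and MA$(\infty)$ coefficients). Norms: for a matrix, $\|A\|_1=\sum_{i,j}|a_{i,j}|$; for a random variable, $\|X\|_{\mathbb{E},q}=(\mathbb{E}|X|^q)^{1/q}$; for $g(\omega)=\sum_rg_re^{ir\omega}$, $\|g\|_K=\sum_{r\in\mathbb{Z}}(2^K+|r|^K)|g_r|$ (so $\|g\|_0=2\sum_r|g_r|$). Quantities: $\rho_{n,K}(f)=\sum_{r=n+1}^\infty|r^K\phi_r(f)|$; $A_K(f,g)=2\sigma_g^{-2}\|\psi_f\|_0\|\phi_g\|_0^2\|\phi_f\|_K$; $C_{f,K}=\frac{3-\varepsilon}{1-\varepsilon}\|\phi_f\|_K^2\|\psi_f\|_K^2$ for some $0<\varepsilon<1$ ($\varepsilon$ does not depend on $n$). $\omega_{k,n}=2\pi k/n$; $(F_n)_{k,t}=n^{-1/2}e^{it\omega_{k,n}}$;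 $\Delta_n(g)=\mathrm{diag}(g(\omega_{1,n}),\ldots,g(\omega_{n,n}))$; $C_n(g)=F_n^*\Delta_n(g)F_n$. With $\phi_t^\infty(\omega;f)=\sum_{s=0}^\infty\phi_{t+s}(f)e^{-is\omega}$, $$(D_{\infty,n}(f))_{k,t}=n^{-1/2}\frac{\phi_t^\infty(\omega_{k,n};f)}{\phi(\omega_{k,n};f)}+n^{-1/2}e^{i\omega_{k,n}}\frac{\overline{\phi_{n+1-t}^\infty(\omega_{k,n};f)}}{\overline{\phi(\omega_{k,n};f)}}.$$ *)

(* Defs.v *)
From HB Require Import structures.
From mathcomp Require Import all_boot all_order all_algebra.
From mathcomp Require Import all_classical all_reals all_analysis.
From mathcomp Require Export complex.

Set Implicit Arguments.
Unset Strict Implicit.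
Unset Printing Implicit Defensive.

Import Order.TTheory GRing.Theory Num.Theory.
Import numFieldNormedType.Exports.

Local Open Scope classical_set_scope.
Local Open Scope ring_scope.
Local Open Scope complex_scope.

(* Normc.normc is the real-valued modulus; `|z| would itself lie in R[i]. *)
Notation cmod := Normc.normc (only parsing).

Section Fourier.
Context {R : realType}.
Implicit Types (g u : int -> R) (a : nat -> R) (K w : R).

(* e^{iw} *)
Definition expi w : R[i] := cos w +i* sin w.

(* Two-sided sums are limits of symmetric partial sums; all those met in the
   theorem are absolutely convergent. *)
Definition sumZ u : R :=
  limn (fun N => \sum_(0 <= k < N.*2.+1) u (k%:Z - N%:Z)).

(* \sum_{r in Z} g_r e^{irw}, for real coefficients g_r. *)
Definition fourier g w : R[i] :=
  sumZ (fun r => g r * cos (r%:~R * w)) +i*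
  sumZ (fun r => g r * sin (r%:~R * w)).

(* The two-sided coefficients of \sum_{s >= 0} a_s e^{-isw}: a_s sits at
   index -s, so that [fourier (causal a)] is that one-sided series. *)
Definition causal a : int -> R := fun r => if (r <= 0)%R then a `|r|%N else 0.

(* \sum_{r in Z} (2^K + |r|^K) |g_r|; here 0 `^ 0 = 1, so that the case K = 0
   is 2 \sum_r |g_r|. *)
Definition normK K g : R :=
  fine (\esum_(r in [set: int])
    ((2 `^ K + `|r%:~R : R| `^ K) * `|g r|)%:E)%E.

Definition frequency n k : R := 2 * pi * k%:R / n%:R.

End Fourier.

Section SpectralDensity.
Context {R : realType}.
Implicit Types (f : R -> R) (c : int -> R).

Definition spectral_density f c : Prop :=
  [/\ forall w, w \in `[0, 2 * pi] -> 0 < f w,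
      forall w, w \in `[0, 2 * pi] -> f (2 * pi - w) = f w,
      forall r, c (- r) = c r &
      forall w, w \in `[0, 2 * pi] -> (f w)%:C = fourier c w].

Definition bounded_away_from_zero f : Prop :=
  exists2 delta, 0 < delta & forall w, w \in `[0, 2 * pi] -> delta <= f w.

(* sigma_f, (phi_j(f))_{j >= 1} and (psi_j(f))_{j >= 1}; the values of [ar] and
   [ma] at 0 are never used. *)
Record canonical_factor := CanonicalFactor { sigma : R; ar : nat -> R; ma : nat -> R }.
Implicit Types (F G : canonical_factor).

Definition phi_coef F : int -> R :=
  causal (fun j => if j == 0%N then 1 else - ar F j).
Definition psi_coef F : int -> R :=
  causal (fun j => if j == 0%N then 1 else ma F j).

Definition phi F (w : R) : R[i] := fourier (phi_coef F) w.
Definition psi F (w : R) : R[i] := fourier (psi_coef F) w.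

(* Since phi and psi = phi^{-1} are both one-sided with summable coefficients,
   1 - \sum_j phi_j z^j has no zero in the closed unit disc: this is the
   causal, minimum phase factorisation. *)
Definition canonical_factorisation f F : Prop :=
  [/\ 0 < sigma F,
      summable [set: int] (EFin \o phi_coef F),
      summable [set: int] (EFin \o psi_coef F),
      forall w, w \in `[0, 2 * pi] -> psi F w = (phi F w)^-1 &
      forall w, w \in `[0, 2 * pi] ->
        f w = sigma F ^+ 2 * cmod (psi F w) ^+ 2 /\
        f w = sigma F ^+ 2 * cmod (phi F w) ^- 2].

(* \sum_{r > n} |r^K phi_r(f)| *)
Definition rho (n : nat) (K : R) F : R :=
  fine (\sum_(n.+1 <= r <oo) `|r%:R `^ K * ar F r|%:E)%E.

Definition A_const (K : R) F G : R :=
  2 * sigma G ^- 2 * normK 0 (psi_coef F) * normK 0 (phi_coef G) ^+ 2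
    * normK K (phi_coef F).

Definition C_const (eps K : R) F : R :=
  (3 - eps) / (1 - eps) * normK K (phi_coef F) ^+ 2 * normK K (psi_coef F) ^+ 2.

End SpectralDensity.

Arguments canonical_factor R : clear implicits.

(* Rows and columns 1, ..., n of the matrices are the i.+1 for i : 'I_n. *)
Section Matrices.
Context {R : realType}.
Implicit Types (n : nat).

Definition mxnorm1 m n (A : 'M[R[i]]_(m, n)) : R :=
  \sum_i \sum_j cmod (A i j).

Definition Gamma n (c : int -> R) : 'M[R]_n := \matrix_(s, t) c (s%:Z - t%:Z).

Definition DFT n : 'M[R[i]]_n :=
  \matrix_(k, t) ((Num.sqrt n%:R)^-1%:C * expi (t.+1%:R * frequency n k.+1)).

Definition adjoint m n (A : 'M[R[i]]_(m, n)) : 'M[R[i]]_(n, m) :=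
  map_mx conjc A^T.

Definition Delta n (g : R -> R) : 'M[R[i]]_n :=
  diag_mx (\row_k (g (frequency n k.+1))%:C).

Definition circulant n (g : R -> R) : 'M[R[i]]_n :=
  adjoint (DFT n) *m Delta n g *m DFT n.

(* \sum_{s >= 0} phi_{t+s}(f) e^{-isw} *)
Definition phi_inf (F : canonical_factor R) (t : nat) (w : R) : R[i] :=
  fourier (causal (fun s => ar F (t + s))) w.

Definition D_inf n (F : canonical_factor R) : 'M[R[i]]_n :=
  \matrix_(k, t)
    let w := frequency n k.+1 in
    (Num.sqrt n%:R)^-1%:C * (phi_inf F t.+1 w / phi F w)
    + (Num.sqrt n%:R)^-1%:C * expi w
      * (conjc (phi_inf F (n.+1 - t.+1) w) / conjc (phi F w)).

Definition gaussian_likelihood n (c : int -> R) (x : 'cV[R]_n) : R :=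
  n%:R^-1 * (x^T *m invmx (Gamma n c) *m x) 0 0.

Definition whittle_likelihood n (f : R -> R) (x : 'cV[R]_n) : R[i] :=
  let z := map_mx (real_complex R) x in
  (n%:R^-1)%:C * (z^T *m circulant n (fun w => (f w)^-1) *m z) 0 0.

Definition sample (T : Type) (X : int -> T -> R) n (o : T) : 'cV[R]_n :=
  \col_(t < n) X t.+1%:Z o.

End Matrices.

(* ||X||_{E,q} = (E|X|^q)^{1/q} is the library's 'N[P]_(q%:E). *)
Definition sup_norm (R : realType) (d : measure_display) (T : measurableType d)
    (P : probability T R) (q : R) (X : int -> {RV P >-> R}) : \bar R :=
  ereal_sup (range (fun t : int => 'N[P]_(q%:E)[EFin \o X t]))%E.

(* Main.v *)
(* Write a for the coefficients of phi (a_0 = 1, a_j = - phi_j) and s for sigma^2.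

   Sampling at the frequencies 2 pi k / n and letting n grow recovers Fourier
   coefficients without integrals; it turns phi psi = 1 and f phi = s conj(psi)
   into a * b = delta and the Yule-Walker equations
   sum_j a_j c(r + j) = s b_r [r >= 0]. The latter transfers the weight |r|^K
   from c to b; inverting b then gives sum_j j^K |a_j| < oo.

   For h an absolutely convergent Fourier series, the l^1 norm over s = 1..n of
   n^-1 sum_k e^(-i s w_k) h(w_k) is at most the l^1 norm of the coefficients of h.
   Since phi_t^oo / (f phi) = s^-1 conj(phi) phi_t^oo, this bounds the columns of
   F* Delta(1/f) D_oo, and summing over t gives the weight j |phi_j|.

   The matrix L = F* Delta(1/f) (F + D_oo) satisfies L Gamma = 1 + E, where E comes
   from truncating the prediction of the infinite past to X_1, ..., X_n; its norm
   is O(rho_(n,K) n^(1-K)). For large n this bounds Gamma^-1 uniformly in the l^1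
   operator norm, and positive definiteness makes the finitely many other n
   harmless, so Gamma^-1 - C_n = F* Delta(1/f) D_oo - E Gamma^-1 has the claimed
   norm up to a constant, which is absorbed by taking eps close to 1. *)
Require Import Defs.
From mathcomp Require Import all_boot all_order all_algebra.
From mathcomp Require Import all_classical all_reals all_analysis.
From mathcomp Require Import measurable_realfun ring lra zify.
Import Order.TTheory GRing.Theory Num.Theory.
Import numFieldNormedType.Exports.
Set Implicit Arguments.
Unset Strict Implicit.
Unset Printing Implicit Defensive.
Local Open Scope classical_set_scope.
Local Open Scope ring_scope.
Local Open Scope complex_scope.

(** * Characters and averages over the Fourier frequencies *)

(** One [eps] has to serve every n, so any constant is acceptable in the second term provided it is
    uniform in n. The obstacle is a bound on the row sums of Gamma^-1 that does not grow with n: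
    positive definiteness alone controls the l^2 operator norm, and passing to row sums would cost a
    factor sqrt n. The approximate inverse supplies the missing uniformity.

    The matrix F + D_oo is the Fourier transform of a completed sample. Up to n^(-1/2), its column t
    collects e^(itw) and the coefficients of X_t in the linear predictions of all values before time
    1 and after time n; phi_t^oo / phi is the generating series obtained by iterating the one-step
    AR(oo) prediction. If the predictions were exact projections on the sample, their errors would
    be uncorrelated with it, and multiplication by Gamma would produce the whole two-sided series
    f(w) e^(isw), which 1/f then cancels. The predictors in D_oo are those of an infinite sample cut
    to n terms, and this cut is the only source of E. *)

Section ComplexModulus.
Context {R : realType}.
Implicit Types (z : R[i]) (x : R).

Lemma cmod_ge0 z : 0 <= cmod z.
Proof. by case: z => x y; exact: sqrtr_ge0. Qed.

Lemma cmodR x : cmod x%:C = `|x|.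
Proof. by rewrite /cmod /= expr0n addr0 sqrtr_sqr. Qed.

Lemma cmodBC z1 z2 : cmod (z1 - z2) = cmod (z2 - z1).
Proof. by rewrite -normcN opprB. Qed.

Lemma cmod_sum (I : Type) (r : seq I) (P : pred I) (G : I -> R[i]) :
  cmod (\sum_(i <- r | P i) G i) <= \sum_(i <- r | P i) cmod (G i).
Proof.
elim/big_rec2 : _ => [|i y x _ h]; first by rewrite Normc.normc0.
by rewrite (le_trans (le_normcD _ _))// lerD2l.
Qed.

Lemma cmodJ z : cmod (conjc z) = cmod z.
Proof. by case: z => x y; rewrite /cmod /= sqrrN. Qed.

Lemma cmod_eq0 z : (cmod z == 0) = (z == 0).
Proof. by apply/eqP/eqP => [/Normc.eq0_normc|->]; rewrite ?Normc.normc0. Qed.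

Lemma mulJc z : conjc z * z = (cmod z ^+ 2)%:C.
Proof.
case: z => x y; rewrite /cmod sqr_sqrtr ?addr_ge0 ?sqr_ge0//=.
by congr (_ +i* _); ring.
Qed.

Lemma real_complexM x y : (x * y)%:C = x%:C * y%:C :> R[i].
Proof. exact: rmorphM. Qed.

Lemma real_complexD x y : (x + y)%:C = x%:C + y%:C :> R[i].
Proof. exact: rmorphD. Qed.

Lemma real_complexN x : (- x)%:C = - x%:C :> R[i].
Proof. exact: rmorphN. Qed.

Lemma real_complex_sum (I : Type) (r : seq I) (P : pred I) (G : I -> R) :
  (\sum_(i <- r | P i) G i)%:C = \sum_(i <- r | P i) (G i)%:C :> R[i].
Proof. exact: rmorph_sum. Qed.

Lemma conjcM z1 z2 : conjc (z1 * z2) = conjc z1 * conjc z2.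
Proof. exact: rmorphM. Qed.

Lemma conjcD z1 z2 : conjc (z1 + z2) = conjc z1 + conjc z2.
Proof. exact: rmorphD. Qed.

Lemma conjcB z1 z2 : conjc (z1 - z2) = conjc z1 - conjc z2.
Proof. exact: rmorphB. Qed.

Lemma conjc_sum (I : Type) (r : seq I) (P : pred I) (G : I -> R[i]) :
  conjc (\sum_(i <- r | P i) G i) = \sum_(i <- r | P i) conjc (G i).
Proof. exact: rmorph_sum. Qed.

Lemma ler_Re_cmod z : `|complex.Re z| <= cmod z.
Proof.
case: z => x y /=; rewrite -sqrtr_sqr ler_sqrt ?addr_ge0 ?sqr_ge0//.
by rewrite lerDl sqr_ge0.
Qed.

Lemma ler_Im_cmod z : `|complex.Im z| <= cmod z.
Proof.
case: z => x y /=; rewrite -sqrtr_sqr ler_sqrt ?addr_ge0 ?sqr_ge0//.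
by rewrite lerDr sqr_ge0.
Qed.

End ComplexModulus.

Section Characters.
Context {R : realType}.
Implicit Types (w x y : R) (m r s : int) (n : nat).

Lemma expiD x y : expi (x + y) = expi x * expi y.
Proof. by rewrite /expi cosD sinD; congr (_ +i* _); ring. Qed.

Lemma expi0 : expi (0 : R) = 1.
Proof. by rewrite /expi cos0 sin0. Qed.

Lemma cmod_expi x : cmod (expi x) = 1.
Proof. by rewrite /cmod /expi /= cos2Dsin2 sqrtr1. Qed.

Lemma conj_expi x : conjc (expi x) = expi (- x).
Proof. by rewrite /expi cosN sinN. Qed.

Definition chi m w : R[i] := expi (m%:~R * w).

Lemma chiD r s w : chi (r + s) w = chi r w * chi s w.
Proof. by rewrite /chi intrD mulrDl expiD. Qed.

Lemma chi0 w : chi 0 w = 1.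
Proof. by rewrite /chi mul0r expi0. Qed.

Lemma chi1 w : chi 1 w = expi w.
Proof. by rewrite /chi mul1r. Qed.

Lemma cmod_chi r w : cmod (chi r w) = 1.
Proof. exact: cmod_expi. Qed.

Lemma conj_chi r w : conjc (chi r w) = chi (- r) w.
Proof. by rewrite /chi conj_expi intrN mulNr. Qed.

Lemma chi_frequency n m k : (0 < n)%N ->
  chi m (frequency n k : R) = chi m (frequency n 1) ^+ k.
Proof.
move=> n0; elim: k => [|k IH].
  by rewrite expr0 /chi /frequency mulr0 mul0r mulr0 expi0.
rewrite exprSr -IH /chi -expiD -mulrDr; congr (expi (_ * _)).
by rewrite /frequency -natr1; ring.
Qed.

Lemma chi_2pi m : chi m (2 * pi : R) = 1.
Proof.
have E (k : nat) : chi k%:Z (2 * pi : R) = 1.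
  elim: k => [|k IH]; first by rewrite chi0.
  rewrite -addn1 PoszD chiD IH chi1 mul1r /expi.
  by rewrite mulr_natl cos2pi sin2pi.
case: (intP m) => [|k|k]; [exact: chi0 | exact: E |].
by rewrite -conj_chi E conjc1.
Qed.

Lemma chi_frequency_period n m : (0 < n)%N -> chi m (frequency n n : R) = 1.
Proof.
move=> n0; rewrite /frequency mulfK ?chi_2pi//.
by rewrite pnatr_eq0 -lt0n.
Qed.

(** Periodicity at the Fourier frequencies: it collapses e^(i(n+1)w) to e^(iw), which is why the
    predictions beyond time n enter [D_inf] with the factor e^(iw). *)
Lemma chi_frequencyS n k : (0 < n)%N -> chi n.+1%:Z (frequency n k : R) = expi (frequency n k).
Proof.
move=> n0; rewrite -addn1 PoszD chiD chi1.
suff -> : chi n%:Z (frequency n k : R) = 1 by rewrite mul1r.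
rewrite chi_frequency// /chi /frequency.
have -> : n%:Z%:~R * (2 * pi * 1%:R / n%:R) = 2 * pi :> R.
  by rewrite mulr1 mulrC divfK// pnatr_eq0 -lt0n.
by have := chi_2pi 1; rewrite chi1 => ->; rewrite expr1n.
Qed.

Lemma chi_mod n m : (0 < n)%N ->
  chi m (frequency n 1 : R) = chi (m %% n%:Z)%Z (frequency n 1).
Proof.
move=> n0; rewrite {1}(divz_eq m n%:Z) chiD.
suff -> : chi ((m %/ n%:Z)%Z * n%:Z) (frequency n 1 : R) = 1 by rewrite mul1r.
rewrite -(chi_2pi (m %/ n)%Z) /chi intrM -mulrA; congr (expi (_ * _)).
by rewrite /frequency mulr1 mulrC divfK// pnatr_eq0 -lt0n.
Qed.

Lemma chi_neq1 n k : (0 < k < n)%N -> chi k%:Z (frequency n 1 : R) != 1.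
Proof.
move=> /andP[k0 kn]; have n0 := ltn_trans k0 kn.
(* With half the angle, the real part is 1 - 2 sin(y)^2, and 0 < y < pi makes it smaller than 1. *)
pose y : R := pi * k%:R / n%:R.
have -> : chi k%:Z (frequency n 1 : R) = expi (y *+ 2).
  by rewrite /chi /frequency /y -mulr_natl; congr expi; rewrite /=; ring.
rewrite /expi eq_complex negb_and; apply/orP; left => /=.
have sy : 0 < sin y.
  apply: sin_gt0_pi; rewrite divr_gt0 ?mulr_gt0 ?pi_gt0 ?ltr0n//=.
  by rewrite ltr_pdivrMr ?ltr0n// ltr_pM2l ?pi_gt0// ltr_nat.
rewrite cos_mulr2n cos2sin2 lt_eqF//.
have : 0 < sin y ^+ 2 by rewrite exprn_gt0.
lra.
Qed.

(** The Riemann sum, over n equispaced frequencies, of the integral that defines the Fourier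
    coefficient of h at s; entries of the matrices at hand take this form by [adjoint_DFT_entry]. *)
Definition avg n s (h : R -> R[i]) : R[i] :=
  (n%:R^-1)%:C * \sum_(k < n) chi (- s) (frequency n k.+1) * h (frequency n k.+1).

Lemma dvdz_small n m : (absz m < n)%N -> (n%:Z %| m)%Z = (m == 0).
Proof.
move=> mn; apply/idP/eqP => [|->]; last exact: dvdz0.
rewrite dvdzE /= => /dvdn_leq h; apply/eqP; rewrite -absz_eq0 -leqn0 leqNgt.
by apply/negP => /h; rewrite leqNgt mn.
Qed.

(** Orthogonality of the n-th roots of unity: only m - s modulo n matters, and the geometric sum of
    the powers of a root other than 1 vanishes. All indices congruent to s alias onto it. *)
Lemma avg_chi n s m : (0 < n)%N ->
  avg n s (chi m) = ((n%:Z %| m - s)%Z)%:R%:C.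
Proof.
move=> n0; rewrite /avg.
under eq_bigr => k _ do rewrite -chiD addrC chi_frequency// exprS.
rewrite -mulr_sumr chi_mod//; set z := chi _ _.
have n0z : n%:Z != 0 by rewrite eqz_nat -lt0n.
have zn : z ^+ n = 1 by rewrite /z -chi_frequency// chi_frequency_period.
have [nm|nm] := boolP (n%:Z %| m - s)%Z.
  have -> : z = 1 by rewrite /z (dvdz_mod0P nm) chi0.
  rewrite mul1r; under eq_bigr do rewrite expr1n.
  rewrite sumr_const card_ord -(rmorph_nat (real_complex R)) -rmorphM /=.
  by rewrite mulVf// pnatr_eq0 -lt0n.
have z1 : z != 1.
  have := modz_ge0 (m - s) n0z; have := ltz_pmod (m - s) (_ : 0 < n%:Z).
  move=> /(_ n0); rewrite /z.
  case E : ((m - s) %% n%:Z)%Z => [k|k]// kn _; apply: chi_neq1.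
  rewrite lt0n; apply/andP; split; last by move: kn; rewrite ltz_nat.
  apply: contraNneq nm => k0.
  by apply/dvdz_mod0P; rewrite E k0.
have : (z - 1) * \sum_(i < n) z ^+ i = 0 by rewrite -subrX1 zn subrr.
by move=> /eqP; rewrite mulf_eq0 subr_eq0 (negbTE z1)/= => /eqP ->; rewrite !mulr0.
Qed.

(** Exactly one s in 1, ..., n is congruent to m modulo n. This unit bound, the same for every
    character, seeds all later l^1 estimates. *)
Lemma sum_avg_chi n m : (0 < n)%N ->
  \sum_(s < n) cmod (avg n s.+1%:Z (chi m)) <= 1.
Proof.
move=> n0; have n0z : n%:Z != 0 by rewrite eqz_nat -lt0n.
have := modz_ge0 (m - 1) n0z; have := ltz_pmod (m - 1) (_ : 0 < n%:Z).
move=> /(_ n0); case E : ((m - 1) %% n%:Z)%Z => [k|k]// kn _.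
rewrite (bigD1 (Ordinal kn))//= big1 ?addr0 => [|s sk].
  by rewrite avg_chi// cmodR ger0_norm ?ler0n// lern1 leq_b1.
rewrite avg_chi//; suff /negbTE -> : ~~ (n%:Z %| m - s.+1%:Z)%Z.
  by rewrite Normc.normc0.
apply: contra sk => h; apply/eqP/val_inj => /=.
have : (n%:Z %| (m - 1) - s%:Z)%Z by move: h; rewrite -addn1 PoszD opprD (addrC (- _)) addrA.
rewrite -eqz_mod_dvd E => /eqP; rewrite modz_small => [[]//|].
by rewrite le0z_nat ltz_nat ltn_ord.
Qed.

Lemma eq_avg n s h1 h2 : (forall k, (k < n)%N ->
    h1 (frequency n k.+1) = h2 (frequency n k.+1)) ->
  avg n s h1 = avg n s h2.
Proof.
by move=> h; rewrite /avg; congr (_ * _); apply: eq_bigr => k _; rewrite h.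
Qed.

Lemma avgD n s h1 h2 :
  avg n s (fun w => h1 w + h2 w) = avg n s h1 + avg n s h2.
Proof.
by rewrite /avg -mulrDr -big_split/=; congr (_ * _); apply: eq_bigr => k _; rewrite mulrDr.
Qed.

Lemma avgZ n s z h : avg n s (fun w => z * h w) = z * avg n s h.
Proof.
rewrite /avg mulrCA; congr (_ * _); rewrite mulr_sumr.
by apply: eq_bigr => k _; rewrite mulrCA.
Qed.

Lemma avgB n s h1 h2 :
  avg n s (fun w => h1 w - h2 w) = avg n s h1 - avg n s h2.
Proof.
have -> : avg n s h1 - avg n s h2 = avg n s h1 + (- 1) * avg n s h2 by ring.
rewrite -avgZ -avgD; apply: eq_avg => k _; ring.
Qed.

Lemma avg_sum n s (I : Type) (r : seq I) (h : I -> R -> R[i]) :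
  avg n s (fun w => \sum_(i <- r) h i w) = \sum_(i <- r) avg n s (h i).
Proof.
elim: r => [|i r IH].
  rewrite big_nil /avg big1 ?mulr0// => k _; by rewrite big_nil mulr0.
rewrite big_cons -IH -avgD; apply: eq_avg => k _; by rewrite big_cons.
Qed.

Lemma avg_shift n s m h : avg n s (fun w => chi m w * h w) = avg n (s - m) h.
Proof.
rewrite /avg; congr (_ * _); apply: eq_bigr => k _.
by rewrite mulrA -chiD opprB addrC.
Qed.

Lemma avgJ n s (h : R -> R[i]) :
  avg n s (fun w => conjc (h w)) = conjc (avg n (- s) h).
Proof.
rewrite /avg conjcM conjc_real conjc_sum; congr (_ * _).
by apply: eq_bigr => k _; rewrite conjcM conj_chi opprK.
Qed.

Lemma cmod_avg_le n s h (M : R) : (0 < n)%N ->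
  (forall k, (k < n)%N -> cmod (h (frequency n k.+1)) <= M) ->
  cmod (avg n s h) <= M.
Proof.
move=> n0 hM; rewrite /avg Normc.normcM cmodR ger0_norm ?invr_ge0// mulrC.
rewrite ler_pdivrMr ?ltr0n// (le_trans (cmod_sum _ _ _))//.
rewrite mulr_natr -[X in _ <= _ *+ X](card_ord n) -sumr_const.
by apply: ler_sum => k _; rewrite Normc.normcM cmod_chi mul1r hM.
Qed.

Lemma frequency_itv n k : (k < n)%N -> (frequency n k.+1 : R) \in `[0, 2 * pi].
Proof.
move=> kn; rewrite in_itv /= /frequency; apply/andP; split.
  by rewrite !mulr_ge0 ?invr_ge0 ?ler0n// pi_ge0.
rewrite ler_pdivrMr ?ltr0n ?(leq_ltn_trans _ kn)//.
by rewrite ler_pM2l ?mulr_gt0 ?pi_gt0// ler_nat.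
Qed.

End Characters.

(** * Absolutely convergent series *)

Section BoundedSums.
Context {R : realType}.
Implicit Types (G : nat -> R) (M : R).

Definition bounded_sums G M :=
  (forall j, 0 <= G j) /\ (forall N, \sum_(j < N) G j <= M).

Definition tail G N := limn (fun P => \sum_(j < P) G j) - \sum_(j < N) G j.

Lemma bounded_sums_ge0 G M : bounded_sums G M -> 0 <= M.
Proof. by case=> _ /(_ 0%N); rewrite big_ord0. Qed.

Lemma nondecreasing_sums G : (forall j, 0 <= G j) ->
  {homo (fun P => \sum_(j < P) G j) : N P / (N <= P)%N >-> N <= P}.
Proof.
move=> G0; apply: homo_leq => [//|? ? ?|P]; first exact: le_trans.
by rewrite big_ord_recr/= lerDl.
Qed.

Lemma bounded_sums_cvg G M : bounded_sums G M -> cvgn (fun P => \sum_(j < P) G j).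
Proof.
move=> [G0 GM]; apply: nondecreasing_is_cvgn; first exact: nondecreasing_sums.
by exists M => _ [N _ <-].
Qed.

Lemma tail_ge G M N P : bounded_sums G M -> (N <= P)%N ->
  \sum_(j < P) G j - \sum_(j < N) G j <= tail G N.
Proof.
move=> GM NP; rewrite /tail lerD2r; 
exact: (nondecreasing_cvgn_le (nondecreasing_sums GM.1) (bounded_sums_cvg GM)).
Qed.

Lemma tail_ge0 G M N : bounded_sums G M -> 0 <= tail G N.
Proof. by move=> GM; rewrite (le_trans _ (tail_ge GM (leqnn N)))// subrr. Qed.

Lemma sum_tail_le G N P : (N <= P)%N ->
  \sum_(j < P) G j - \sum_(j < N) G j = \sum_(N <= j < P) G j.
Proof.
by move=> NP; rewrite -!(big_mkord xpredT) (big_cat_nat (n := N))//= addrAC subrr add0r.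
Qed.

Lemma tailE G M N P : bounded_sums G M -> (N <= P)%N ->
  tail G N = \sum_(N <= j < P) G j + tail G P.
Proof. by move=> GM NP; rewrite -sum_tail_le// /tail; ring. Qed.

Lemma tail_le G M N : bounded_sums G M -> tail G N <= M.
Proof.
move=> GM; apply: le_trans (_ : tail G 0 <= _).
  rewrite (tailE (N := 0) GM (leq0n N)) lerDr sumr_ge0// => j _; exact: GM.1.
rewrite /tail big_ord0 subr0; apply: limr_le; first exact: bounded_sums_cvg GM.
by apply: nearW => P; exact: GM.2.
Qed.

Lemma tail_small G M e : bounded_sums G M -> 0 < e ->
  exists N, forall P, (N <= P)%N -> tail G P < e.
Proof.
move=> GM e0; have /cvgrPdist_lt /(_ e e0) [N _ NP] := bounded_sums_cvg GM.
by exists N => P /NP /=; rewrite ltr_norml => /andP[].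
Qed.

End BoundedSums.

Section ComplexSeries.
Context {R : realType}.
Implicit Types (z : nat -> R[i]) (G : nat -> R).

Definition csum z : R[i] :=
  limn (fun N => \sum_(j < N) complex.Re (z j)) +i*
  limn (fun N => \sum_(j < N) complex.Im (z j)).

Lemma cvg_le_tail (u : nat -> R) G M : bounded_sums G M ->
  (forall j, `|u j| <= G j) -> cvgn (fun N => \sum_(j < N) u j).
Proof.
move=> GM uG.
have -> : (fun N => \sum_(j < N) u j) = series u.
  by apply/funext => N; rewrite /series /= big_mkord.
apply: normed_cvg; apply: (series_le_cvg _ GM.1 uG) => [n|]; first exact: normr_ge0.
have -> : series G = (fun N => \sum_(j < N) G j).
  by apply/funext => N; rewrite /series /= big_mkord.
exact: bounded_sums_cvg GM.
Qed.

Lemma csum_tail z G M N : bounded_sums G M -> (forall j, cmod (z j) <= G j) ->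
  cmod (csum z - \sum_(j < N) z j) <= tail G N.
Proof.
move=> GM zG.
have cx : cvgn (fun N => \sum_(j < N) complex.Re (z j)).
  apply: (@cvg_le_tail (fun j => complex.Re (z j)) G M GM) => j.
  exact: le_trans (ler_Re_cmod _) (zG j).
have cy : cvgn (fun N => \sum_(j < N) complex.Im (z j)).
  apply: (@cvg_le_tail (fun j => complex.Im (z j)) G M GM) => j.
  exact: le_trans (ler_Im_cmod _) (zG j).
have t0 := tail_ge0 N GM.
have ReS (P : nat) : complex.Re (\sum_(j < P) z j) = \sum_(j < P) complex.Re (z j).
  by elim/big_rec2 : _ => [//|i y [a b] _ <-]; case: (z i).
have ImS (P : nat) : complex.Im (\sum_(j < P) z j) = \sum_(j < P) complex.Im (z j).
  by elim/big_rec2 : _ => [//|i y [a b] _ <-]; case: (z i).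
set S := \sum_(j < N) z j.
have E : csum z - S = (limn (fun N => \sum_(j < N) complex.Re (z j)) - complex.Re S)
    +i* (limn (fun N => \sum_(j < N) complex.Im (z j)) - complex.Im S).
  by case: S.
rewrite E /cmod -[leRHS]ger0_norm// -sqrtr_sqr ler_wsqrtr//.
(* The bound on partial sums passes to the limit in squared form, where it is a polynomial in two
   real limits. *)
have : (fun P => (\sum_(j < P) complex.Re (z j) - complex.Re S) ^+ 2 +
   (\sum_(j < P) complex.Im (z j) - complex.Im S) ^+ 2) @ \oo -->
   (limn (fun N => \sum_(j < N) complex.Re (z j)) - complex.Re S) ^+ 2 +
   (limn (fun N => \sum_(j < N) complex.Im (z j)) - complex.Im S) ^+ 2.
  by apply: cvgD; apply: cvgM; apply: cvgB => //; exact: cvg_cst.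
move/cvgr_to_le; apply; near=> P.
have NP : (N <= P)%N by near: P; exact: nbhs_infty_ge.
have : cmod (\sum_(j < P) z j - S) <= tail G N.
  apply: le_trans (tail_ge GM NP); rewrite sum_tail_le//.
  have -> : \sum_(j < P) z j - S = \sum_(N <= j < P) z j.
    by rewrite /S -!(big_mkord xpredT) (big_cat_nat (n := N))//= addrAC subrr add0r.
  by rewrite (le_trans (cmod_sum _ _ _))// ler_sum.
rewrite -!ReS -!ImS; case: (\sum_(j < P) z j) => a b; case: S {E} => x y /=.
rewrite /cmod => h.
by rewrite -[leLHS]sqr_sqrtr ?addr_ge0 ?sqr_ge0// ler_sqr ?nnegrE ?sqrtr_ge0.
Unshelve. all: by end_near.
Qed.

Lemma csum_bound z G M : bounded_sums G M -> (forall j, cmod (z j) <= G j) ->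
  cmod (csum z) <= M.
Proof.
move=> GM zG; have := csum_tail 0 GM zG.
rewrite big_ord0 subr0 => /le_trans; apply.
rewrite /tail big_ord0 subr0; apply: limr_le; first exact: bounded_sums_cvg GM.
by apply: nearW => P; exact: GM.2.
Qed.

Definition clim z (l : R[i]) := forall e, 0 < e ->
  exists N, forall n, (N <= n)%N -> cmod (z n - l) < e.

Lemma clim_near z1 z2 (l : R[i]) N : (forall n, (N <= n)%N -> z1 n = z2 n) ->
  clim z1 l -> clim z2 l.
Proof.
move=> h c e /c[P hP]; exists (maxn N P) => n; rewrite geq_max => /andP[Nn Pn].
by rewrite -h// hP.
Qed.

Lemma clim_shift (z : nat -> R[i]) l : clim z l -> clim (fun n => z n.+1) l.
Proof. by move=> c e /c[N h]; exists N => n Nn; apply: h; lia. Qed.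

Lemma clim_cst l : clim (fun=> l) l.
Proof. by move=> e e0; exists 0%N => n _; rewrite subrr Normc.normc0. Qed.

Lemma climD z1 z2 (l1 l2 : R[i]) : clim z1 l1 -> clim z2 l2 ->
  clim (fun n => z1 n + z2 n) (l1 + l2).
Proof.
move=> c1 c2 e e0; have e2 : 0 < e / 2 by rewrite divr_gt0.
have [N1 h1] := c1 _ e2; have [N2 h2] := c2 _ e2.
exists (maxn N1 N2) => n; rewrite geq_max => /andP[/h1 k1 /h2 k2].
rewrite opprD addrACA (le_lt_trans (le_normcD _ _))//.
by rewrite [ltRHS](splitr e) ltrD.
Qed.

Lemma climZ a z l : clim z l -> clim (fun n => a * z n) (a * l).
Proof.
move=> c e e0; have p : 0 < e / (cmod a + 1).
  by rewrite divr_gt0// ltr_wpDl// cmod_ge0.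
have [N h] := c _ p; exists N => n /h; rewrite -mulrBr Normc.normcM => k.
rewrite (@le_lt_trans _ _ ((cmod a + 1) * cmod (z n - l)))//.
  by rewrite ler_wpM2r ?cmod_ge0// lerDl.
by rewrite mulrC -ltr_pdivlMr// ltr_wpDl// cmod_ge0.
Qed.

Lemma clim_sum (I : Type) (r : seq I) (z : I -> nat -> R[i]) (l : I -> R[i]) :
  (forall i, clim (z i) (l i)) ->
  clim (fun n => \sum_(i <- r) z i n) (\sum_(i <- r) l i).
Proof.
move=> h; elim: r => [|i r IH].
  rewrite big_nil; apply: (@clim_near _ _ _ 0 _ (clim_cst 0)) => n _.
  by rewrite big_nil.
rewrite big_cons; apply: (@clim_near _ _ _ 0 _ (climD (h i) IH)) => n _.
by rewrite big_cons.
Qed.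

Lemma clim_le z l (M : R) N : (forall n, (N <= n)%N -> cmod (z n) <= M) ->
  clim z l -> cmod l <= M.
Proof.
move=> zM c; apply/ler_addgt0Pr => e e0; have [P h] := c _ e0.
have := h _ (leq_maxr N P); rewrite cmodBC => k.
rewrite -[l](subrK (z (maxn N P))) (le_trans (le_normcD _ _))// addrC lerD//.
  by rewrite zM// leq_maxl.
exact: ltW.
Qed.

Lemma clim_unique z (l1 l2 : R[i]) : clim z l1 -> clim z l2 -> l1 = l2.
Proof.
move=> c1 c2; apply/eqP; rewrite -subr_eq0 -cmod_eq0 eq_le cmod_ge0 andbT.
have c : clim (fun=> 0) (l1 - l2).
  rewrite -mulN1r; apply: (@clim_near _ _ _ 0 _ (climD c1 (climZ (-1) c2))) => n _.
  by rewrite mulN1r subrr.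
by apply: (clim_le (N := 0%N)) c => n _; rewrite Normc.normc0.
Qed.

Lemma climJ z (l : R[i]) : clim z l -> clim (fun n => conjc (z n)) (conjc l).
Proof. by move=> c e /c[N h]; exists N => n /h; rewrite -conjcB cmodJ. Qed.

Lemma cvg_sum (I : Type) (r : seq I) (u : I -> nat -> R) (l : I -> R) :
  (forall i, u i @ \oo --> l i) ->
  (fun n => \sum_(i <- r) u i n) @ \oo --> \sum_(i <- r) l i.
Proof.
move=> ul; elim: r => [|i r IH].
  by rewrite big_nil; under eq_fun do rewrite big_nil; exact: cvg_cst.
by rewrite big_cons; under eq_fun do rewrite big_cons; exact: cvgD.
Qed.

Lemma clim_cvg (u : nat -> R) (l : R) : clim (fun n => (u n)%:C) l%:C ->
  u @ \oo --> l.
Proof.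
move=> c; apply/cvgrPdist_lt => e /c[N h]; exists N => // n /= /h.
by rewrite -(rmorphB (real_complex R)) cmodR distrC.
Qed.

End ComplexSeries.

(** * Fourier series and their discrete coefficients *)

Section FourierSeries.
Context {R : realType}.
Implicit Types (g : int -> R) (a : nat -> R) (w M : R) (n N : nat) (s r : int).

(** Pairing r with -r turns symmetric two-sided partial sums into ordinary partial sums; index 0 has
    no partner and is counted once. *)
Definition fold (V : nmodType) (u : int -> V) (j : nat) : V :=
  if j is 0 then u 0 else u j%:Z + u (- j%:Z).

Lemma sym_sumE (V : nmodType) (u : int -> V) N :
  \sum_(0 <= k < N.*2.+1) u (k%:Z - N%:Z) = \sum_(j < N.+1) fold u j.
Proof.
elim: N => [|N IH]; first by rewrite big_nat1 big_ord_recl big_ord0 subrr addr0.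
rewrite big_ord_recr/= -IH doubleS big_nat_recl// big_nat_recr//=.
have -> : \sum_(0 <= i < N.*2.+1) u (i.+1%:Z - N.+1%:Z) =
    \sum_(0 <= k < N.*2.+1) u (k%:Z - N%:Z).
  by apply: eq_bigr => k _; congr u; lia.
have -> : (N.*2.+2)%:Z - N.+1%:Z = N.+1%:Z by rewrite -addnn; lia.
by rewrite sub0r addrCA; congr (_ + _); rewrite addrC.
Qed.

Lemma cmod_fold (u : int -> R[i]) j : cmod (fold u j) <= fold (fun r => cmod (u r)) j.
Proof. by case: j => [|j] //=; exact: le_normcD. Qed.

Lemma fourier_csum g w :
  fourier g w = csum (fold (fun r => (g r)%:C * chi r w)).
Proof.
have E (u : int -> R) : sumZ u = limn (fun N => \sum_(j < N) fold u j).
  rewrite /sumZ.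
  have -> : (fun N => \sum_(0 <= k < N.*2.+1) u (k%:Z - N%:Z)) =
      [sequence (fun N => \sum_(j < N) fold u j) n.+1]_n.
    by apply/funext => N; rewrite sym_sumE.
  by congr (get _); apply/funext => l; exact: cvg_shiftS.
rewrite /fourier /csum !E; congr (limn _ +i* limn _); apply/funext => N.
  apply: eq_bigr => -[j _] _ /=; case: j => [|j] /=;
  by rewrite /chi /expi /= !mul0r !subr0.
apply: eq_bigr => -[j _] _ /=; case: j => [|j] /=;
  by rewrite /chi /expi /= !mul0r !addr0.
Qed.

Lemma fold_cmod g w j : cmod (fold (fun r => (g r)%:C * chi r w) j) <=
  fold (fun r => `|g r|) j.
Proof.
rewrite (le_trans (cmod_fold _ _))//; case: j => [|j]; rewrite /fold;
by rewrite !Normc.normcM !cmod_chi !mulr1 !cmodR.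
Qed.

Definition bounded_coefs g M := bounded_sums (fold (fun r => `|g r|)) M.

Lemma cmod_fourier g M w : bounded_coefs g M -> cmod (fourier g w) <= M.
Proof.
by move=> gM; rewrite fourier_csum (csum_bound gM)// => j; exact: fold_cmod.
Qed.

Lemma fourier_tail g M N w : bounded_coefs g M ->
  cmod (fourier g w - \sum_(0 <= k < N.*2.+1) (g (k%:Z - N%:Z))%:C * chi (k%:Z - N%:Z) w)
    <= tail (fold (fun r => `|g r|)) N.+1.
Proof.
move=> gM; rewrite fourier_csum (sym_sumE (fun r => (g r)%:C * chi r w)).
by apply: (csum_tail _ gM) => j; exact: fold_cmod.
Qed.

(** The series is cut at |r| <= N with an error uniform in w. Once n exceeds N + |s|, no other
    retained index aliases onto s, so the average of the trigonometric polynomial is exactly g_s. *)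
Lemma clim_avg_fourier g M s : bounded_coefs g M ->
  clim (fun n => avg n s (fourier g)) (g s)%:C.
Proof.
move=> gM e e0; have [N0 N0e] := tail_small gM e0.
pose N := (N0 + `|s|)%N; have {N0e} Ne : tail (fold (fun r => `|g r|)) N.+1 < e.
  by apply: N0e; rewrite /N; lia.
exists (N + `|s|).+1 => n nN; have n0 : (0 < n)%N by lia.
have sN : `|(s + N%:Z)%R|%N = s + N%:Z :> int by rewrite /N; lia.
have -> : (g s)%:C = avg n s (fun w => \sum_(0 <= k < N.*2.+1)
    (g (k%:Z - N%:Z))%:C * chi (k%:Z - N%:Z) w).
  rewrite avg_sum; under eq_bigr do rewrite avgZ avg_chi//.
  rewrite big_mkord.
  have sN2 : (`|(s + N%:Z)%R| < N.*2.+1)%N by rewrite -addnn /N; lia.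
  rewrite (bigD1 (Ordinal sN2))//= big1 ?addr0 => [|k kN].
    by rewrite sN addrK subrr dvdz0 mulr1.
  have kN2 : (nat_of_ord k < (N + N).+1)%N by rewrite addnn.
  rewrite dvdz_small; last by clear -kN2 nN; lia.
  suff /negbTE -> : k%:Z - N%:Z - s != 0 by rewrite mulr0.
  by apply: contra kN => /eqP ks; apply/eqP/val_inj => /=; lia.
rewrite -avgB (le_lt_trans _ Ne)//; apply: cmod_avg_le => // k _.
exact: (fourier_tail _ _ gM).
Qed.

Lemma clim_avg1 (s : int) :
  clim (fun n => avg n s (chi 0 : R -> R[i])) ((s == 0)%:R : R)%:C.
Proof.
apply: (@clim_near _ _ _ _ `|s|.+1 _ (clim_cst _)) => n sn.
rewrite avg_chi; last by lia.
by rewrite sub0r dvdz_small ?oppr_eq0// abszN; lia.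
Qed.

Lemma fold_causal (V : nmodType) a (h : R -> int -> V) j : (forall r, h 0 r = 0) ->
  fold (fun r => h (causal a r) r) j = h (a j) (- j%:Z).
Proof. by move=> h0; case: j => [|j] //=; rewrite h0 add0r. Qed.

Definition summable_coefs a M := bounded_sums (fun j => `|a j|) M.

Lemma bounded_causalE a M : bounded_coefs (causal a) M = summable_coefs a M.
Proof.
rewrite /bounded_coefs /summable_coefs; congr bounded_sums; apply/funext => j.
by rewrite (@fold_causal _ a (fun x _ => `|x|))// => _; rewrite normr0.
Qed.

Lemma bounded_causal a M : summable_coefs a M -> bounded_coefs (causal a) M.
Proof. by rewrite bounded_causalE. Qed.

Lemma fourier_causal a w :
  fourier (causal a) w = csum (fun j => (a j)%:C * chi (- j%:Z) w).
Proof.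
rewrite fourier_csum; congr csum; apply/funext => j.
by rewrite (@fold_causal _ a (fun x r => x%:C * chi r w))// => r; rewrite mul0r.
Qed.

Lemma causal_tail a M N w : summable_coefs a M ->
  cmod (fourier (causal a) w - \sum_(j < N) (a j)%:C * chi (- j%:Z) w) <=
    tail (fun j => `|a j|) N.
Proof.
move=> aM; rewrite fourier_causal; apply: (csum_tail _ aM) => j.
by rewrite Normc.normcM cmod_chi mulr1 cmodR.
Qed.

Lemma cmod_causal a M w : summable_coefs a M -> cmod (fourier (causal a) w) <= M.
Proof. by move=> /bounded_causal/cmod_fourier. Qed.

(* Multiplication by [fourier (causal a)] convolves the limiting averages, as
   it is the uniform limit of combinations of characters, which shift them. *)
Lemma fourier_causal_mul a M (H P : R -> R[i]) (B : R) (d p : int -> R) :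
  summable_coefs a M ->
  (forall w, w \in `[0, 2 * pi] -> cmod (H w) <= B) ->
  (forall w, w \in `[0, 2 * pi] -> fourier (causal a) w * H w = P w) ->
  (forall s, clim (fun n => avg n s H) (d s)%:C) ->
  (forall s, clim (fun n => avg n s P) (p s)%:C) ->
  forall s, (fun N => \sum_(j < N) a j * d (s + j%:Z)) @ \oo --> p s.
Proof.
move=> aM HB HP cH cP s.
have B0 : 0 <= B by rewrite (le_trans (cmod_ge0 _) (HB 0 _))// in_itv/= lexx mulr_ge0// pi_ge0.
(* The estimate holds for the averages at every n >= 1, and n is sent to infinity with N fixed; only
   afterwards does N grow. *)
have main N : `|p s - \sum_(j < N) a j * d (s + j%:Z)| <= tail (fun j => `|a j|) N * B.
  rewrite -cmodR rmorphB rmorph_sum /=.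
  have c : clim (fun n => avg n s P - \sum_(j < N) (a j)%:C * avg n (s + j%:Z) H)
      ((p s)%:C - \sum_(j < N) (a j * d (s + j%:Z))%:C).
    rewrite -mulN1r; under [in X in clim _ X]eq_bigr do rewrite rmorphM.
    apply: (@clim_near _ _ _ _ 0 _ (climD (cP s) (climZ (-1) (clim_sum _
       (fun j : 'I_N => climZ (a j)%:C (cH (s + j%:Z))))))) => n _.
    by rewrite mulN1r.
  apply: (clim_le (N := 1%N)) c => n n0.
  have -> : avg n s P - \sum_(j < N) (a j)%:C * avg n (s + j%:Z) H =
     avg n s (fun w => (fourier (causal a) w - \sum_(j < N) (a j)%:C * chi (- j%:Z) w) * H w).
    transitivity (avg n s P - avg n s (fun w => \sum_(j < N) (a j)%:C * (chi (- j%:Z) w * H w))).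
      congr (_ - _); rewrite avg_sum; apply: eq_bigr => j _.
      by rewrite avgZ avg_shift opprK.
    rewrite -avgB; apply: eq_avg => k kn; rewrite mulrBl HP ?frequency_itv//.
    by rewrite mulr_suml; congr (_ - _); apply: eq_bigr => j _; rewrite mulrA.
  apply: cmod_avg_le => // k kn; rewrite Normc.normcM ler_pM ?cmod_ge0//.
    exact: causal_tail aM.
  by rewrite HB// frequency_itv.
apply/cvgrPdist_lt => e e0.
have B1 : 0 < B + 1 by rewrite ltr_wpDl.
have [N h] := tail_small aM (divr_gt0 e0 B1).
exists N => // n /= /h k; rewrite (le_lt_trans (main n))//.
rewrite (@le_lt_trans _ _ (tail (fun j => `|a j|) n * (B + 1)))//.
  by rewrite ler_wpM2l ?lerDl// (tail_ge0 _ aM).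
by rewrite -ltr_pdivlMr.
Qed.

End FourierSeries.

(** * Sums of tails and the origin of the weight j *)

Section DoubleSums.
Context {R : realType}.
Implicit Types (G : nat -> R) (S M : R).

(** After exchanging the sums, G_j is counted once for each t < n with m + t <= j, hence at most j +
    1 - m times when j >= m; m >= 1 bounds this by j. *)
Lemma sum_sum_tail_le G m n P : (0 < m)%N -> (forall j, 0 <= G j) ->
  \sum_(t < n) \sum_(m + t <= j < P) G j <= \sum_(m <= j < P) j%:R * G j.
Proof.
move=> m0 G0.
have E t : \sum_(m + t <= j < P) G j = \sum_(0 <= j < P | (m + t <= j)%N) G j.
  rewrite big_mkcond [RHS]big_mkcond/=.
  by rewrite -!big_mkcond/= (big_nat_widenl _ 0).
under eq_bigr do rewrite E big_mkcond.
rewrite exchange_big/= [leRHS](big_nat_widenl _ 0)//= [leRHS]big_mkcond/=.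
apply: ler_sum => j _; case: ifPn => mj; last first.
  rewrite big1// => t _; case: ifPn => // h; move: mj.
  by rewrite (leq_trans _ h)// leq_addr.
have card_le : (\sum_(t < n) (m + t <= j) <= minn n (j.+1 - m))%N.
  elim: n => [|k IH]; first by rewrite big_ord0.
  rewrite big_ord_recr/=; move: IH; set z := (\sum_(_ < _) _)%N => IH.
  by have [h|h] := leqP (m + k) j; clearbody z; lia.
rewrite (_ : \sum_(i < n) _ = (\sum_(t < n) (m + t <= j))%N%:R * G j); last first.
  rewrite natr_sum mulr_suml; apply: eq_bigr => t _.
  by case: leqP; rewrite ?mul1r ?mul0r.
by rewrite ler_wpM2r// ler_nat (leq_trans card_le)//; lia.
Qed.

Lemma sum_tail_weighted G M S m n : (0 < m)%N -> bounded_sums G M ->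
  (forall P, \sum_(m <= j < P) j%:R * G j <= S) ->
  \sum_(t < n) tail G (m + t) <= S.
Proof.
move=> m0 GM GS; apply/ler_addgt0Pr => e e0.
(* Each of the n tails beyond N is below e / (n + 1), so their total is at most e. *)
have [N h] := tail_small GM (divr_gt0 e0 (ltr0Sn _ n)).
pose P := (N + (m + n))%N.
rewrite (@le_trans _ _ (\sum_(t < n) (\sum_(m + t <= j < P) G j + e / n.+1%:R)))//.
  apply: ler_sum => t _; rewrite (tailE (P := P) GM) ?lerD2l; last first.
    by rewrite /P; have := ltn_ord t; lia.
  by apply/ltW/h; rewrite /P; lia.
rewrite big_split/= lerD//; first by rewrite (le_trans (sum_sum_tail_le _ _ _ GM.1)).
rewrite sumr_const card_ord -[leLHS]mulr_natr mulrAC ler_pdivrMr ?ltr0n//.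
by rewrite ler_pM2l// ler_nat.
Qed.

Lemma shift_sums G M t : bounded_sums G M ->
  bounded_sums (fun s => G (t + s)%N) (tail G t).
Proof.
move=> GM; split=> [j|N]; first exact: GM.1.
rewrite (le_trans _ (tail_ge GM (leq_addr N t)))// sum_tail_le ?leq_addr//.
rewrite -[X in \sum_(X <= _ < _) _]add0n big_addn addKn big_mkord.
by apply: ler_sum => j _; rewrite addnC.
Qed.

End DoubleSums.

(** * The l^1 norm of discrete Fourier coefficients *)

Section DFTNorm.
Context {R : realType}.
Implicit Types (n : nat) (h : R -> R[i]) (a : nat -> R) (X : R) (m : int).

Definition dft_norm n h : R := \sum_(s < n) cmod (avg n s.+1%:Z h).

Lemma eq_dft_norm n h1 h2 : (forall k, (k < n)%N ->
    h1 (frequency n k.+1) = h2 (frequency n k.+1)) -> dft_norm n h1 = dft_norm n h2.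
Proof. by move=> h; apply: eq_bigr => s _; rewrite (eq_avg _ h). Qed.

Lemma dft_normD n h1 h2 :
  dft_norm n (fun w => h1 w + h2 w) <= dft_norm n h1 + dft_norm n h2.
Proof.
by rewrite /dft_norm -big_split; apply: ler_sum => s _; rewrite avgD le_normcD.
Qed.

Lemma dft_normZ n z h : dft_norm n (fun w => z * h w) = cmod z * dft_norm n h.
Proof.
rewrite /dft_norm mulr_sumr; apply: eq_bigr => s _.
by rewrite avgZ Normc.normcM.
Qed.

Lemma dft_norm_sum n (I : Type) (r : seq I) (h : I -> R -> R[i]) :
  dft_norm n (fun w => \sum_(i <- r) h i w) <= \sum_(i <- r) dft_norm n (h i).
Proof.
rewrite /dft_norm exchange_big/=; apply: ler_sum => s _.
by rewrite avg_sum cmod_sum.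
Qed.

Lemma dft_norm_le n h (M : R) : (0 < n)%N ->
  (forall k, (k < n)%N -> cmod (h (frequency n k.+1)) <= M) ->
  dft_norm n h <= n%:R * M.
Proof.
move=> n0 hM; rewrite mulr_natl -[X in _ <= _ *+ X](card_ord n) -sumr_const.
by apply: ler_sum => s _; exact: cmod_avg_le.
Qed.

(* Quantifying over all [m] makes the bound stable under multiplication by
   characters, hence by absolutely convergent Fourier series. *)
Definition wiener n h X := forall m, dft_norm n (fun w => chi m w * h w) <= X.

Lemma wiener_dft_norm n h X : wiener n h X -> dft_norm n h <= X.
Proof.
move=> /(_ 0); congr (_ <= _); apply: eq_dft_norm => k _.
by rewrite chi0 mul1r.
Qed.

Lemma wiener_chi n m : (0 < n)%N -> wiener n (chi m) 1.
Proof.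
move=> n0 r; rewrite (_ : dft_norm _ _ = dft_norm n (chi (r + m))); last first.
  by apply: eq_dft_norm => k _; rewrite chiD.
exact: sum_avg_chi.
Qed.

Lemma wiener_chiM n m h X : wiener n h X -> wiener n (fun w => chi m w * h w) X.
Proof.
move=> hX r; rewrite (le_trans _ (hX (r + m)))// le_eqVlt; apply/orP; left.
by apply/eqP/eq_dft_norm => k _; rewrite chiD mulrA.
Qed.

(** The exponents [e] are free so that both a causal series and its conjugate are covered. For fixed
    n the truncation error is paid for crudely, by n times a supremum; it vanishes as N grows, so
    the final bound does not involve n. *)
Lemma wiener_series n a A h X (e : nat -> int) (F : R -> R[i]) : (0 < n)%N ->
  summable_coefs a A -> wiener n h X ->
  (forall N w, cmod (F w - \sum_(j < N) (a j)%:C * chi (e j) w) <=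
     tail (fun j => `|a j|) N) ->
  wiener n (fun w => F w * h w) (A * X).
Proof.
move=> n0 aA hX Fa m.
pose B := \sum_(k < n) cmod (h (frequency n k.+1)).
have X0 : 0 <= X by rewrite (le_trans _ (hX 0))// sumr_ge0// => *; exact: cmod_ge0.
have B0 : 0 <= B by rewrite sumr_ge0// => *; exact: cmod_ge0.
have hB k : (k < n)%N -> cmod (h (frequency n k.+1)) <= B.
  move=> kn; rewrite /B (bigD1 (Ordinal kn))//= lerDl sumr_ge0// => *.
  exact: cmod_ge0.
apply/ler_addgt0Pr => eps e0.
have nB : 0 < n%:R * (B + 1) by rewrite mulr_gt0 ?ltr0n// ltr_wpDl.
have [N hN] := tail_small aA (divr_gt0 e0 nB).
rewrite (_ : dft_norm _ _ = dft_norm n (fun w =>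
   \sum_(j < N) (a j)%:C * (chi m w * (chi (e j) w * h w)) +
   chi m w * (F w - \sum_(j < N) (a j)%:C * chi (e j) w) * h w)); last first.
  apply: eq_dft_norm => k _; set w := frequency _ _.
  have -> : \sum_(j < N) (a j)%:C * (chi m w * (chi (e j) w * h w)) =
     chi m w * (\sum_(j < N) (a j)%:C * chi (e j) w) * h w.
    by rewrite mulr_sumr mulr_suml; apply: eq_bigr => j _; ring.
  by ring.
rewrite (le_trans (dft_normD _ _ _))// lerD//.
  rewrite (le_trans (dft_norm_sum _ _ _))//.
  rewrite (@le_trans _ _ (\sum_(j < N) `|a j| * X))//; last first.
    by rewrite -mulr_suml ler_wpM2r// aA.2.
  apply: ler_sum => j _; rewrite dft_normZ cmodR ler_wpM2l//.
  exact: wiener_chiM hX m.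
rewrite (@le_trans _ _ (n%:R * (eps / (n%:R * (B + 1)) * (B + 1))))//.
  apply: dft_norm_le => // k kn; rewrite !Normc.normcM cmod_chi mul1r.
  rewrite ler_pM ?cmod_ge0//; last by rewrite (le_trans (hB k kn))// lerDl.
  by rewrite (le_trans (Fa _ _))// ltW// hN.
rewrite le_eqVlt; apply/orP; left; apply/eqP; field.
by rewrite pnatr_eq0 -lt0n n0 gt_eqF// ltr_wpDl.
Qed.

Lemma wiener_causal n a A h X : (0 < n)%N ->
  summable_coefs a A -> wiener n h X ->
  wiener n (fun w => fourier (causal a) w * h w) (A * X).
Proof.
move=> n0 aA hX; apply: (wiener_series n0 aA hX (e := fun j => - j%:Z)) => N w.
exact: causal_tail aA.
Qed.

Lemma wiener_causalJ n a A h X : (0 < n)%N ->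
  summable_coefs a A -> wiener n h X ->
  wiener n (fun w => conjc (fourier (causal a) w) * h w) (A * X).
Proof.
move=> n0 aA hX; apply: (wiener_series n0 aA hX (e := fun j => j%:Z)) => N w.
rewrite (le_trans _ (causal_tail N w aA))// -[leRHS]cmodJ conjcB conjc_sum.
rewrite le_eqVlt; apply/orP; left; apply/eqP; congr (cmod (_ - _)).
by apply: eq_bigr => j _; rewrite conjcM conjc_real conj_chi opprK.
Qed.

Lemma wiener_cst n : (0 < n)%N -> wiener n (fun=> 1) 1.
Proof.
move=> n0 m; rewrite (le_trans _ (wiener_chi m n0 0))// le_eqVlt; apply/orP; left.
by apply/eqP/eq_dft_norm => k _; rewrite chi0 mul1r mulr1.
Qed.

Lemma adjoint_DFT_entry n p (g : R -> R) (D : 'M[R[i]]_(n, p)) (d : R -> R[i]) s t :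
  (forall k, D k t = (Num.sqrt n%:R)^-1%:C * d (frequency n k.+1)) ->
  (adjoint (DFT n) *m Delta n g *m D) s t =
    avg n s.+1%:Z (fun w => (g w)%:C * d w).
Proof.
move=> DE; rewrite /Delta mul_mx_diag mxE /avg mulr_sumr; apply: eq_bigr => k _.
rewrite !mxE DE conjcM conjc_real conj_expi.
have -> : (n%:R^-1 : R)%:C = (Num.sqrt n%:R)^-1%:C * (Num.sqrt n%:R)^-1%:C.
  by rewrite -rmorphM -invfM -expr2 sqr_sqrtr.
rewrite /chi rmorphN mulNr; ring.
Qed.

End DFTNorm.

(** * Weighted inversion of causal sequences *)

Section Convolution.
Context {R : realType}.
Implicit Types (a b x y z X Y : nat -> R) (K : R).

Definition conv_seq a b r : R := \sum_(j < r.+1) a j * b (r - j)%N.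

Lemma sum_triangle (V : nmodType) (F : nat -> nat -> V) N :
  \sum_(r < N) \sum_(j < r.+1) F j (r - j)%N =
  \sum_(j < N) \sum_(k < N - j) F j k.
Proof.
under eq_bigr => r _.
  rewrite (big_ord_widen_cond N xpredT (fun j => F j (r - j)%N)) ?ltn_ord//=.
  over.
rewrite (exchange_big_dep xpredT)//=; apply: eq_bigr => j _.
rewrite -(big_mkord xpredT (fun k => F j k)).
rewrite -(big_mkord (fun r => (j < r.+1)%N) (fun r => F j (r - j)%N)).
transitivity (\sum_(0 + j <= r < N) F j (r - j)%N).
  by rewrite add0n [RHS](big_nat_widenl _ 0)//=; apply: eq_bigl => i; rewrite ltnS.
rewrite big_addn.
by apply: eq_bigr => k _; rewrite addnK.
Qed.

Lemma sum_conv_le X Y N : (forall j, 0 <= X j) -> (forall j, 0 <= Y j) ->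
  \sum_(r < N) \sum_(j < r.+1) X j * Y (r - j)%N <=
  (\sum_(j < N) X j) * (\sum_(j < N) Y j).
Proof.
move=> X0 Y0; rewrite (sum_triangle (fun j k => X j * Y k)) mulr_suml.
apply: ler_sum => j _; rewrite -mulr_sumr ler_wpM2l//.
exact: (nondecreasing_sums Y0 (leq_subr _ _)).
Qed.

(** Coefficients up to r of a Cauchy product involve only coefficients up to r, so both sides are
    coefficients of products of truncated polynomials, where multiplication is associative. *)
Lemma convA x y z r : conv_seq (conv_seq x y) z r = conv_seq x (conv_seq y z) r.
Proof.
pose p u : {poly R} := \poly_(i < r.+1) u i.
have pE u i : (i <= r)%N -> (p u)`_i = u i by move=> ir; rewrite coef_poly ltnS ir.
have pM u v i : (i <= r)%N -> (p u * p v)`_i = conv_seq u v i.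
  move=> ir; rewrite coefM; apply: eq_bigr => j _.
  by rewrite !pE//; have := ltn_ord j; lia.
transitivity (p x * p y * p z)`_r; last rewrite -mulrA.
  rewrite coefM; apply: eq_bigr => j _.
  by rewrite pM ?pE//; have := ltn_ord j; lia.
rewrite coefM; apply: eq_bigr => j _.
by rewrite pM ?pE//; have := ltn_ord j; lia.
Qed.

Lemma powR_addn_le K j k : 0 <= K ->
  (j + k)%N%:R `^ K <= 2 `^ K * (j%:R `^ K + k%:R `^ K) :> R.
Proof.
move=> K0; wlog jk : j k / (j <= k)%N => [h|].
  by have [jk|/ltnW kj] := leqP j k; [exact: h | rewrite addnC addrC h].
rewrite (@le_trans _ _ ((2 * k%:R) `^ K))//.
  rewrite ge0_ler_powR// ?nnegrE ?mulr_ge0//.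
  by rewrite -natrM ler_nat mul2n -addnn leq_add2r.
by rewrite powRM// ler_wpM2l ?powR_ge0// lerDr powR_ge0.
Qed.

(** The weight is subadditive up to the factor 2^K, so it can be moved onto one factor of each
    product at a time. *)
Lemma weighted_conv_seq_le K x y N : 0 <= K ->
  \sum_(r < N) r%:R `^ K * `|conv_seq x y r| <= 2 `^ K *
   ((\sum_(j < N) j%:R `^ K * `|x j|) * (\sum_(j < N) `|y j|) +
    (\sum_(j < N) `|x j|) * (\sum_(j < N) j%:R `^ K * `|y j|)).
Proof.
move=> K0; pose W u j : R := j%:R `^ K * `|u j : R|.
have W0 u j : 0 <= W u j by rewrite mulr_ge0// powR_ge0.
apply: le_trans (_ : 2 `^ K *
  (\sum_(r < N) \sum_(j < r.+1) W x j * `|y (r - j)%N| +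
   \sum_(r < N) \sum_(j < r.+1) `|x j| * W y (r - j)%N) <= _); last first.
  rewrite ler_wpM2l ?powR_ge0// lerD//.
    exact: (sum_conv_le N (W0 x) (fun j => normr_ge0 (y j))).
  exact: (sum_conv_le N (fun j => normr_ge0 (x j)) (W0 y)).
rewrite -big_split mulr_sumr; apply: ler_sum => r _ /=.
rewrite -big_split mulr_sumr (@le_trans _ _ (r%:R `^ K * \sum_(j < r.+1) `|x j * y (r - j)%N|))//.
  by rewrite ler_wpM2l ?powR_ge0// ler_norm_sum.
rewrite mulr_sumr; apply: ler_sum => j _ /=; rewrite normrM.
have := @powR_addn_le K j (r - j) K0; rewrite subnKC; last by have := ltn_ord j; lia.
move/(ler_wpM2r (mulr_ge0 (normr_ge0 (x j)) (normr_ge0 (y (r - j)%N)))).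
by move/le_trans; apply; rewrite le_eqVlt; apply/orP; left; apply/eqP; rewrite /W; ring.
Qed.

Lemma conv_seq_le x y N :
  \sum_(r < N) `|conv_seq x y r| <= (\sum_(j < N) `|x j|) * (\sum_(j < N) `|y j|).
Proof.
apply: le_trans (sum_conv_le N (fun j => normr_ge0 (x j)) (fun j => normr_ge0 (y j))).
apply: ler_sum => r _.
by rewrite (le_trans (ler_norm_sum _ _ _))//; apply: ler_sum => j _; rewrite normrM.
Qed.

Definition delta0 r : R := (r == 0%N)%:R.

(* Truncating [a] to a polynomial [p] makes [e = (a - p) * b] small in l^1 while
   [e = 1 - p * b] keeps a finite weighted norm; then [a = p + e * a] bounds the
   weighted partial sums of [a] by a constant plus half of themselves. *)
Lemma weighted_inverse K a b A B BK : 0 < K ->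
  summable_coefs a A -> summable_coefs b B -> conv_seq a b =1 delta0 ->
  bounded_sums (fun j => j%:R `^ K * `|b j|) BK ->
  exists AK, bounded_sums (fun j => j%:R `^ K * `|a j|) AK.
Proof.
move=> K0 aA bB ab bK; have K0' := ltW K0.
have B0 := bounded_sums_ge0 bB; have A0 := bounded_sums_ge0 aA.
have BK0 := bounded_sums_ge0 bK.
have p2 : 0 < 2 `^ K :> R by rewrite powR_gt0.
have e0 : 0 < (2 * 2 `^ K * (B + 1))^-1 :> R.
  by rewrite invr_gt0 !mulr_gt0// ltr_wpDl.
have [P hP] := tail_small aA e0.
pose p j : R := if (j < P)%N then a j else 0.
pose q j : R := if (j < P)%N then 0 else a j.
pose e := conv_seq q b.
have W0 (u : nat -> R) j : 0 <= j%:R `^ K * `|u j| by rewrite mulr_ge0// powR_ge0.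
have apq j : a j = p j + q j by rewrite /p /q; case: ifP; rewrite ?addr0 ?add0r.
have aE r : a r = p r + conv_seq e a r.
  rewrite convA apq; congr (_ + _).
  have E i : conv_seq b a i = delta0 i.
    rewrite -ab /conv_seq (reindex_inj rev_ord_inj)/=; apply: eq_bigr => j _.
    by rewrite mulrC subSS subKn// -ltnS.
  rewrite [RHS]/conv_seq (bigD1 ord_max)//= subnn E /delta0 eqxx mulr1 big1 ?addr0//.
  move=> j jr; rewrite E /delta0; case: eqP => [h|]; last by rewrite mulr0.
  move: jr; rewrite -val_eqE /=; have := ltn_ord j; lia.
have eE r : e r = delta0 r - conv_seq p b r.
  by rewrite -ab /e /conv_seq -sumrB; apply: eq_bigr => j _; rewrite apq; ring.
have pA N : \sum_(j < N) `|p j| <= A.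
  apply: le_trans (aA.2 N); apply: ler_sum => j _; rewrite /p.
  by case: ifP => // _; rewrite normr0.
have qt N : \sum_(j < N) `|q j| <= (2 * 2 `^ K * (B + 1))^-1.
  apply: le_trans (ltW (hP P (leqnn P))); apply: le_trans (tail_ge aA (leq_addr N P)).
  rewrite (sum_tail_le (fun j => `|a j|) (leq_addr N P)) [leRHS](big_nat_widenl _ 0)//=.
  rewrite [leRHS]big_mkcond/= big_mkord.
  have q0 j : 0 <= `|q j| by [].
  rewrite (le_trans (nondecreasing_sums q0 (leq_addl P N)))//; apply: ler_sum => j _.
  by rewrite /q ltnNge; case: leqP => _ //=; rewrite normr0.
have e1 N : \sum_(j < N) `|e j| <= (2 * 2 `^ K)^-1.
  rewrite (le_trans (conv_seq_le _ _ _))//.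
  rewrite (@le_trans _ _ ((2 * 2 `^ K * (B + 1))^-1 * (B + 1)))//.
    by rewrite ler_pM ?sumr_ge0// (le_trans (bB.2 N))// lerDl.
  by rewrite invfM -mulrA mulVf ?mulr1// gt_eqF// ltr_wpDl.
pose PK := \sum_(j < P) j%:R `^ K * `|a j|.
have pK N : \sum_(j < N) j%:R `^ K * `|p j| <= PK.
  rewrite (le_trans (nondecreasing_sums (W0 p) (leq_maxl N P)))//.
  rewrite /PK (big_ord_widen _ (fun j => j%:R `^ K * `|a j|) (leq_maxr N P)).
  rewrite [leRHS]big_mkcond/=; apply: ler_sum => j _; rewrite /p.
  by case: ifP => //; rewrite normr0 mulr0.
have PK0 : 0 <= PK by exact: sumr_ge0.
pose EK := 2 `^ K * (PK * B + A * BK).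
have eK N : \sum_(j < N) j%:R `^ K * `|e j| <= EK.
  rewrite (@le_trans _ _ (\sum_(j < N) j%:R `^ K * `|conv_seq p b j|))//.
    (* K > 0 makes the weight vanish at index 0, the only place where e differs from -(p * b). *)
    apply: ler_sum => j _; rewrite eE /delta0; case: eqP => [->|_].
      by rewrite powR0 ?mul0r// gt_eqF.
    by rewrite sub0r normrN.
  rewrite (le_trans (weighted_conv_seq_le _ _ _ K0'))// ler_pM2l//.
  by rewrite lerD// ler_pM ?sumr_ge0//; [exact: bB.2|exact: bK.2].
have EK0 : 0 <= EK by rewrite (le_trans _ (eK 0%N))// big_ord0.
exists (2 * (PK + 2 `^ K * (EK * A))); split => // N.
set S := \sum_(j < N) _.
have : S <= PK + 2 `^ K * (EK * A + (2 * 2 `^ K)^-1 * S).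
  apply: le_trans (_ : \sum_(j < N) (j%:R `^ K * `|p j| + j%:R `^ K * `|conv_seq e a j|) <= _).
    by apply: ler_sum => j _; rewrite -mulrDr ler_wpM2l ?powR_ge0// aE ler_normD.
  rewrite big_split; apply: lerD; first exact: pK.
  rewrite (le_trans (weighted_conv_seq_le e a N K0'))// ler_pM2l//.
  have S0 : 0 <= S by exact: sumr_ge0.
  by rewrite lerD// ler_pM ?sumr_ge0//; exact: aA.2.
have -> : 2 `^ K * (EK * A + (2 * 2 `^ K)^-1 * S) = 2 `^ K * (EK * A) + S / 2.
  by field; rewrite gt_eqF.
lra.
Qed.

End Convolution.

(** * Explicit bounds from summability and from [normK] *)

Section Summability.
Context {R : realType}.
Implicit Types (g : int -> R) (a G : nat -> R) (K M : R).

Lemma summable_bounded_coefs g : summable [set: int] (EFin \o g) ->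
  exists M, bounded_coefs g M.
Proof.
rewrite summableE => gfin; set S := esum _ _ in gfin.
have G0 j : 0 <= fold (fun r => `|g r|) j by case: j => [|j] //=; rewrite addr_ge0.
exists (fine S); split => // N.
rewrite (le_trans (nondecreasing_sums G0 (leqnSn N)))//.
rewrite -(sym_sumE (fun r => `|g r|)) -lee_fin fineK//.
apply: esum_ge; pose s := [seq k%:Z - N%:Z | k <- iota 0 N.*2.+1].
have us : uniq s by rewrite map_inj_uniq ?iota_uniq// => x y /addIr[].
exists [set` s]; first by split => //; exact: finite_seq.
rewrite -fsbig_seq// /s big_map -sumEFin /index_iota subn0 le_eqVlt.
by apply/orP; left; apply/eqP/eq_bigr => k _.
Qed.

Lemma bounded_coefs_of_weighted g K M : 0 <= K ->
  bounded_coefs (fun r => `|r%:~R| `^ K * g r) M ->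
  bounded_coefs g (M + `|g 0|).
Proof.
move=> K0 gM; split => [j|N]; first by case: j => [|j] //=; rewrite addr_ge0.
rewrite addrC; apply: le_trans (_ : `|g 0| + \sum_(j < N)
  fold (fun r => `| `|r%:~R| `^ K * g r|) j <= _); last by rewrite lerD2l gM.2.
have h (r : int) : r != 0 -> `|g r| <= `| `|r%:~R : R| `^ K * g r|.
  move=> r0; rewrite normrM ler_peMl// ger0_norm ?powR_ge0//.
  have r1 : 1 <= `|r%:~R : R| by rewrite -intr_norm -[1]/(1%:~R) ler_int; lia.
  by have := ler_powR r1 K0; rewrite powRr0.
case: N => [|N]; first by rewrite !big_ord0 addr0.
rewrite !big_ord_recl/= lerD2l ler_wpDl//; apply: ler_sum => j _.
by rewrite /fold /= lerD// h.
Qed.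

Lemma bounded_sums_series G M n : bounded_sums G M ->
  [/\ (\sum_(n <= j <oo) (G j)%:E \is a fin_num)%E,
      forall P, \sum_(n <= j < P) G j <= fine (\sum_(n <= j <oo) (G j)%:E)%E &
      fine (\sum_(n <= j <oo) (G j)%:E)%E <= M].
Proof.
move=> [G0 GM].
have G0' m : (n <= m)%N -> (0 <= (G m)%:E)%E by rewrite lee_fin.
have le : (\sum_(n <= j <oo) (G j)%:E <= M%:E)%E.
  apply: lime_le; first by apply: is_cvg_nneseries => m nm _; exact: G0'.
  apply: nearW => P; rewrite sumEFin lee_fin (le_trans _ (GM P))//.
  rewrite (big_nat_widenl _ 0)//= big_mkord big_mkcond/=.
  by apply: ler_sum => j _; case: ifP.
have fin : (\sum_(n <= j <oo) (G j)%:E)%E \is a fin_num.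
  rewrite ge0_fin_numE ?(le_lt_trans le) ?ltry//.
  by apply: nneseries_ge0 => m nm _; exact: G0'.
split=> // [P|]; last by rewrite -lee_fin fineK.
rewrite -lee_fin fineK// -sumEFin; apply: nneseries_lim_ge => m nm _; exact: G0'.
Qed.

Lemma esum_causal (W : int -> R) a : (forall r, 0 <= W r) ->
  (\esum_(r in [set: int]) (W r * `|causal a r|)%:E =
   \sum_(0 <= j <oo) (W (- j%:Z) * `|a j|)%:E)%E.
Proof.
move=> W0; rewrite nneseries_esumT; last by move=> n; rewrite lee_fin mulr_ge0.
transitivity (\esum_(r in [set r : int | (r <= 0)%R]) (W r * `|a `|r|%N|)%:E)%E.
  rewrite [RHS]esum_mkcond; apply: eq_esum => r _; rewrite /causal.
  case: ifPn => r0; first by rewrite ifT// inE.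
  by rewrite ifF ?normr0 ?mulr0// memNset//=; exact/negP.
rewrite (reindex_esum [set: nat] _ (fun j : nat => - j%:Z)).
  by apply: eq_esum => j _; congr (_ * `|a _|)%:E; lia.
split => [j _|x y _ _ /oppr_inj[]//|r /= r0]; first by rewrite /=; lia.
by exists `|r|%N => //; lia.
Qed.

(** The hypothesis only provides finiteness, and [M] disappears from the conclusion: [normK] is read
    through [fine], which would turn an infinite sum into 0. *)
Lemma normK_causal K a M :
  bounded_sums (fun j => (2 `^ K + j%:R `^ K) * `|a j|) M ->
  forall P, \sum_(j < P) (2 `^ K + j%:R `^ K) * `|a j| <= normK K (causal a).
Proof.
move=> aM P; rewrite /normK esum_causal => [|r]; last by rewrite addr_ge0 ?powR_ge0.
have E (j : nat) : `|(- j%:Z)%:~R : R| = j%:R by rewrite intrN normrN ger0_norm.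
under eq_eseriesr do rewrite E.
by have [_ /(_ P) + _] := bounded_sums_series 0 aM; rewrite big_mkord.
Qed.

End Summability.

(** * Consequences of the canonical factorisation *)

Section Factorisation.
Context {R : realType}.
Implicit Types (F : canonical_factor R).

Definition phi_seq F (j : nat) : R := if j == 0%N then 1 else - ar F j.
Definition psi_seq F (j : nat) : R := if j == 0%N then 1 else ma F j.

Context (K : R) (f : R -> R) (c : int -> R) (F : canonical_factor R)
  (K1 : 1 < K) (fc : spectral_density f c) (fF : canonical_factorisation f F)
  (cK : summable [set: int] (fun r : int => (`|r%:~R : R| `^ K * c r)%:E)).

Let a := phi_seq F.
Let b := psi_seq F.

Lemma weighted_c : exists M, bounded_coefs (fun r => `|r%:~R| `^ K * c r) M.
Proof. exact: summable_bounded_coefs cK. Qed.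

Lemma bounded_c : exists M, bounded_coefs c M.
Proof.
have [M cM] := weighted_c; exists (M + `|c 0|).
by apply: bounded_coefs_of_weighted cM; rewrite (le_trans _ (ltW K1)).
Qed.

Lemma summable_phi : exists A, summable_coefs a A.
Proof.
have [_ /summable_bounded_coefs[A h] _ _ _] := fF.
by exists A; rewrite -bounded_causalE.
Qed.

Lemma summable_psi : exists B, summable_coefs b B.
Proof.
have [_ _ /summable_bounded_coefs[B h] _ _] := fF.
by exists B; rewrite -bounded_causalE.
Qed.

(** A zero of phi would give psi = 0, the inverse of 0 being 0, and then f = 0, against
    positivity. *)
Lemma phi_neq0 w : w \in `[0, 2 * pi] -> phi F w != 0.
Proof.
move=> wI; have [f0 _ _ _] := fc; have [_ _ _ h1 h2] := fF.
have := f0 _ wI; have [-> _] := h2 _ wI; rewrite h1//.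
by apply: contraTneq => ->; rewrite invr0 Normc.normc0 expr0n mulr0 ltxx.
Qed.

Lemma phi_psi w : w \in `[0, 2 * pi] -> phi F w * psi F w = 1.
Proof.
by move=> wI; have [_ _ _ h _] := fF; rewrite h// mulfV// phi_neq0.
Qed.

Lemma phi_f w : w \in `[0, 2 * pi] ->
  phi F w * (f w)%:C = (sigma F ^+ 2)%:C * conjc (psi F w).
Proof.
move=> wI; have [_ _ _ _ h] := fF; have [-> _] := h _ wI.
rewrite real_complexM -mulJc mulrCA (mulrCA (phi F w)).
by rewrite phi_psi// mulr1.
Qed.

Lemma invf_phi w : w \in `[0, 2 * pi] ->
  ((f w)^-1)%:C = (sigma F ^- 2)%:C * (conjc (phi F w) * phi F w).
Proof.
move=> wI; have [_ _ _ _ h] := fF; have [_ ->] := h _ wI.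
by rewrite invfM invrK mulJc -real_complexM.
Qed.

(** Coefficients are compared at index -r, since [causal] places b_j at -j; the partial sums in N
    are constant from N = r + 1 on, so their limit is the finite convolution. *)
Lemma conv_phi_psi : conv_seq a b =1 delta0.
Proof.
have [A aA] := summable_phi; have [B bB] := summable_psi.
move=> r; have := @fourier_causal_mul _ a A (psi F) (chi 0) B (causal b)
  (fun s => (s == 0)%:R) aA (fun w _ => cmod_causal w bB)
  (fun w wI => etrans (phi_psi wI) (esym (chi0 w)))
  (fun s => clim_avg_fourier s (bounded_causal bB)).
move=> /(_ clim_avg1 (- r%:Z)); rewrite oppr_eq0 eqz_nat => cv.
have : (fun N => \sum_(j < N) a j * causal b (- r%:Z + j%:Z)) @ \oo --> conv_seq a b r.
  apply: cvg_near_cst; exists r.+1 => // N /= rN.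
  rewrite /conv_seq (big_ord_widen _ (fun j => a j * b (r - j)%N) rN).
  rewrite [RHS]big_mkcond/=.
  apply: eq_bigr => j _; rewrite /causal ltnS; case: leqP => jr.
    by rewrite ifT; [congr (_ * b _)|]; lia.
  by rewrite ifF ?mulr0//; lia.
by move=> h; rewrite -(cvg_lim (@Rhausdorff R) h) (cvg_lim (@Rhausdorff R) cv).
Qed.

(** Conjugation reflects the indices of psi, hence [causal b (- s)]: b_s for s >= 0 and zero
    otherwise. *)
Lemma yule_walker s :
  (fun N => \sum_(j < N) a j * c (s + j%:Z)) @ \oo -->
    sigma F ^+ 2 * causal b (- s).
Proof.
have [A aA] := summable_phi; have [B bB] := summable_psi; have [M cM] := bounded_c.
have [_ _ _ fE] := fc.
apply: (@fourier_causal_mul _ a A (fun w => (f w)%:C)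
  (fun w => (sigma F ^+ 2)%:C * conjc (psi F w)) M c
  (fun s => sigma F ^+ 2 * causal b (- s)) aA).
- by move=> w wI; rewrite fE// (cmod_fourier _ cM).
- exact: phi_f.
- move=> r; apply: (@clim_near _ _ _ _ 0 _ (clim_avg_fourier r cM)) => n _.
  by apply: eq_avg => k kn; rewrite fE// frequency_itv.
- move=> r; rewrite real_complexM -[(causal b _)%:C]conjc_real.
  apply: (@clim_near _ _ _ _ 0 _ (climZ _ (climJ
    (clim_avg_fourier (- r) (bounded_causal bB))))) => n _.
  by rewrite avgZ avgJ.
Qed.

Lemma sigma2_gt0 : 0 < sigma F ^+ 2.
Proof. by have [h _ _ _ _] := fF; rewrite exprn_gt0. Qed.

(** The case of a negative index: the one-step prediction error is uncorrelated with the past. This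
    is what makes [remainder] a tail. *)
Lemma yule_walker0 m : (0 < m)%N ->
  (fun N => \sum_(j < N) a j * c (j%:Z - m%:Z)) @ \oo --> (0 : R).
Proof.
move=> m0; have := @yule_walker (- m%:Z).
rewrite opprK /causal ifF; last by lia.
by rewrite mulr0; under eq_fun do under eq_bigr do rewrite addrC.
Qed.

(** Since r <= r + j, sigma^2 r^K |b_r| is at most the sum over j of |a_j| (r + j)^K |c(r + j)|; for
    each j the sum over r of the weighted covariances is at most M. *)
Lemma weighted_psi : exists M, bounded_sums (fun j => j%:R `^ K * `|b j|) M.
Proof.
have [A aA] := summable_phi; have [M cM] := weighted_c.
exists (sigma F ^- 2 * (A * M)); split => [j|P]; first by rewrite mulr_ge0 ?powR_ge0.
have K0 : 0 <= K by rewrite (le_trans _ (ltW K1)).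
have s0 := sigma2_gt0.
rewrite mulrC ler_pdivlMr// mulrC.
have : (fun N => \sum_(r < P) r%:R `^ K * `|\sum_(j < N) a j * c (r%:Z + j%:Z)|)
    @ \oo --> sigma F ^+ 2 * \sum_(r < P) r%:R `^ K * `|b r|.
  rewrite mulr_sumr; apply: cvg_sum => r; rewrite mulrCA; apply: cvgMl_tmp.
  have -> : sigma F ^+ 2 * `|b r| = `|sigma F ^+ 2 * causal b (- r%:Z)|.
    rewrite normrM (gtr0_norm s0) /causal ifT; last by lia.
    by congr (_ * `|b _|); lia.
  by apply: cvg_norm; exact: yule_walker.
move/cvgr_to_le; apply; apply: nearW => N.
apply: le_trans (_ : \sum_(j < N) `|a j| * M <= _); last first.
  by rewrite -mulr_suml ler_wpM2r ?aA.2// (bounded_sums_ge0 cM).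
apply: le_trans (_ : \sum_(r < P) \sum_(j < N)
    `|a j| * `| `|(r + j)%N%:Z%:~R| `^ K * c (r + j)%N%:Z| <= _).
  apply: ler_sum => r _; rewrite (le_trans (ler_wpM2l (powR_ge0 _ _) (ler_norm_sum _ _ _)))//.
  rewrite mulr_sumr; apply: ler_sum => j _; rewrite normrM mulrCA ler_wpM2l//.
  rewrite normrM ler_wpM2r// ger0_norm ?powR_ge0// ge0_ler_powR// ?nnegrE//.
  by rewrite ger0_norm// ler_nat leq_addr.
rewrite exchange_big/=; apply: ler_sum => j _; rewrite -mulr_sumr ler_wpM2l//.
apply: le_trans (cM.2 (j + P)%N).
rewrite -(big_mkord xpredT (fun i => fold _ i)) (big_cat_nat (n := j))//= ?leq_addr//.
rewrite ler_wpDl ?sumr_ge0// => [i _|]; first exact: cM.1.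
rewrite -[X in \sum_(X <= _ < _) _]add0n big_addn addKn big_mkord; apply: ler_sum => r _.
by rewrite /fold; case: (r + j)%N => [|i]//; rewrite lerDl.
Qed.

Lemma weighted_phi : exists M, bounded_sums (fun j => j%:R `^ K * `|a j|) M.
Proof.
have [A aA] := summable_phi; have [B bB] := summable_psi; have [M bM] := weighted_psi.
apply: (weighted_inverse _ aA bB conv_phi_psi bM).
by rewrite (lt_trans _ K1).
Qed.

End Factorisation.

(** * Prediction from a finite sample *)

Section CausalSeries.
Context {R : realType}.
Implicit Types (x y d : nat -> R) (c : int -> R) (w M : R).

Lemma clim_causal x M w : summable_coefs x M ->
  clim (fun N => \sum_(j < N) (x j)%:C * chi (- j%:Z) w) (fourier (causal x) w).
Proof.
move=> xM e e0; have [N h] := tail_small xM e0.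
exists N => n /h k; rewrite cmodBC (le_lt_trans _ k)//.
exact: causal_tail xM.
Qed.

Lemma fourier_causal_recl x M w : summable_coefs x M ->
  fourier (causal x) w = (x 0%N)%:C + chi (-1) w * fourier (causal (fun j => x j.+1)) w.
Proof.
move=> xM; have xM' : summable_coefs (fun j => x j.+1) (tail (fun j => `|x j|) 1).
  exact: shift_sums 1 xM.
apply: clim_unique (clim_shift (clim_causal w xM)) _.
apply: (@clim_near _ _ _ _ 0 _ (climD (clim_cst _) (climZ _ (clim_causal w xM')))) => n _.
rewrite big_ord_recl/= oppr0 chi0 mulr1 mulr_sumr; congr (_ + _).
apply: eq_bigr => j _; rewrite mulrCA -chiD; congr (_ * chi _ _).
by rewrite /bump /= -[(1 + j)%N]/j.+1; lia.
Qed.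

Lemma fourier_causal_sum (I : Type) (r : seq I) (x : I -> nat -> R) (M : I -> R)
    (k : I -> R) w M' :
  (forall i, summable_coefs (x i) (M i)) ->
  summable_coefs (fun u => \sum_(i <- r) x i u * k i) M' ->
  \sum_(i <- r) fourier (causal (x i)) w * (k i)%:C =
  fourier (causal (fun u => \sum_(i <- r) x i u * k i)) w.
Proof.
move=> xM sM; apply: clim_unique _ (clim_causal w sM).
under [in X in clim _ X]eq_bigr do rewrite mulrC.
apply: (@clim_near _ _ _ _ 0 _
  (clim_sum r (fun i => climZ (k i)%:C (clim_causal w (xM i))))) => n _.
under eq_bigr do rewrite mulr_sumr.
rewrite exchange_big/=; apply: eq_bigr => j _.
rewrite real_complex_sum mulr_suml; apply: eq_bigr => i _.
by rewrite real_complexM; ring.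
Qed.

Lemma fourier_causalD x y M M' w : summable_coefs x M -> summable_coefs y M' ->
  fourier (causal (fun u => x u + y u)) w = fourier (causal x) w + fourier (causal y) w.
Proof.
move=> xM yM.
have sM : summable_coefs (fun u => x u + y u) (M + M').
  split => // N; rewrite (le_trans _ (lerD (xM.2 N) (yM.2 N)))// -big_split.
  by apply: ler_sum => j _; rewrite ler_normD.
apply: clim_unique (clim_causal w sM) _.
apply: (@clim_near _ _ _ _ 0 _ (climD (clim_causal w xM) (clim_causal w yM))) => n _.
by rewrite -big_split; apply: eq_bigr => j _; rewrite real_complexD mulrDl.
Qed.

Lemma summable_conv x d A M : summable_coefs x A -> summable_coefs d M ->
  summable_coefs (conv_seq x d) (A * M).
Proof.
move=> xA dM; split => // N; rewrite (le_trans (conv_seq_le _ _ _))//.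
by rewrite ler_pM ?sumr_ge0//; [exact: xA.2|exact: dM.2].
Qed.

(** Mertens' argument. In [s n] the inner tails are small for j < N1, being taken at n - j >= N2;
    for j >= N1 they are only bounded by M, but there the sum of |x_j| is small. *)
Lemma fourier_conv x d A M w : summable_coefs x A -> summable_coefs d M ->
  fourier (causal (conv_seq x d)) w = fourier (causal x) w * fourier (causal d) w.
Proof.
move=> xA dM; apply: clim_unique (clim_causal w (summable_conv xA dM)) _.
have A0 := bounded_sums_ge0 xA; have M0 := bounded_sums_ge0 dM.
set D := fourier (causal d) w.
pose s N := \sum_(j < N) (x j)%:C * chi (- j%:Z) w *
  (\sum_(k < N - j) (d k)%:C * chi (- k%:Z) w - D).
have E N : \sum_(j < N) (conv_seq x d j)%:C * chi (- j%:Z) w =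
    s N + D * \sum_(j < N) (x j)%:C * chi (- j%:Z) w.
  rewrite /s mulr_sumr -big_split/=.
  transitivity (\sum_(r < N) \sum_(j < r.+1)
     ((x j)%:C * chi (- j%:Z) w) * ((d (r - j)%N)%:C * chi (- (r - j)%N%:Z) w)).
    apply: eq_bigr => r _; rewrite real_complex_sum mulr_suml.
    apply: eq_bigr => j _; rewrite real_complexM.
    have -> : chi (- r%:Z) w = chi (- j%:Z) w * chi (- (r - j)%N%:Z) w.
      by rewrite -chiD; congr chi; have := ltn_ord j; lia.
    by ring.
  rewrite (sum_triangle (fun j k => ((x j)%:C * chi (- j%:Z) w) * ((d k)%:C * chi (- k%:Z) w))).
  apply: eq_bigr => j _; rewrite -mulr_sumr; ring.
rewrite mulrC -[D * _]add0r.
apply: (@clim_near _ (fun N => s N + D * \sum_(j < N) (x j)%:C * chi (- j%:Z) w) _ _ 0).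
  by move=> n _; rewrite E.
apply: climD; last exact/climZ/(clim_causal w xA).
move=> e e0; have AM : 0 < A + M + 1 by rewrite ltr_wpDl// addr_ge0.
have [N1 h1] := tail_small xA (divr_gt0 e0 AM).
have [N2 h2] := tail_small dM (divr_gt0 e0 AM).
set e' := e / (A + M + 1) in h1 h2; have e'0 : 0 < e' by rewrite divr_gt0.
exists (N1 + N2)%N => n Nn; rewrite subr0.
apply: le_lt_trans (_ : A * e' + M * e' < _); last first.
  by rewrite -mulrDl /e' mulrCA gtr_pMr// ltr_pdivrMr// mul1r ltrDl.
apply: le_trans (_ : \sum_(j < n) (`|x j| * e' + (if (N1 <= j)%N then `|x j| else 0) * M) <= _).
  rewrite (le_trans (cmod_sum _ _ _))//; apply: ler_sum => j _.
  rewrite !Normc.normcM cmodR cmod_chi mulr1 cmodBC.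
  have dt := causal_tail (n - j) w dM; have [Nj|Nj] := leqP N1 j.
    apply: ler_wpDl; first by rewrite mulr_ge0// ltW.
    by rewrite ler_wpM2l// (le_trans dt)//; exact: tail_le dM.
  by rewrite mul0r addr0 ler_wpM2l// (le_trans dt)// ltW// h2//; lia.
rewrite big_split; apply: lerD => /=; rewrite -mulr_suml.
  by apply: ler_wpM2r; [exact: ltW|exact: xA.2].
rewrite mulrC ler_wpM2l// ltW// (le_lt_trans _ (h1 N1 (leqnn _)))//.
have N1n : (N1 <= n)%N by lia.
rewrite (le_trans _ (tail_ge xA N1n))// (sum_tail_le (fun j => `|x j|) N1n).
by rewrite [leRHS](big_nat_widenl _ 0)//= [leRHS]big_mkcond/= big_mkord.
Qed.

End CausalSeries.

Section Prediction.
Context {R : realType}.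
Implicit Types (c : int -> R) (n s u : nat) (w M : R).

Definition future c s : nat -> R := fun v => c (v%:Z + s%:Z).

Lemma sum_shift_le c M s N : bounded_coefs c M -> \sum_(v < N) `|c (v%:Z + s%:Z)| <= M.
Proof.
move=> cM; apply: le_trans (cM.2 (s + N)%N).
rewrite -(big_mkord xpredT (fun i => fold _ i)) (big_cat_nat (n := s))//= ?leq_addr//.
rewrite ler_wpDl ?sumr_ge0// => [i _|]; first exact: cM.1.
rewrite -[X in \sum_(X <= _ < _) _]add0n big_addn addKn big_mkord; apply: ler_sum => r _.
by rewrite -PoszD /fold; case: (r + s)%N => [|i]//; rewrite lerDl.
Qed.

Lemma summable_future c M s : bounded_coefs c M -> summable_coefs (future c s) M.
Proof. by move=> cM; split => // N; exact: sum_shift_le. Qed.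

Lemma fourier_split c M w : bounded_coefs c M -> (forall r, c (- r) = c r) ->
  fourier c w = fourier (causal (future c 0)) w
    + chi 1 w * conjc (fourier (causal (future c 1)) w).
Proof.
move=> cM ceven.
have h0 := clim_causal w (summable_future 0 cM).
have h1 := clim_causal w (summable_future 1 cM).
have h : clim (fun N => \sum_(j < N) fold (fun r => (c r)%:C * chi r w) j) (fourier c w).
  move=> e e0; have [N hN] := tail_small cM e0; exists N => n /hN k.
  rewrite cmodBC (le_lt_trans _ k)// fourier_csum; apply: (csum_tail _ cM) => j.
  exact: fold_cmod.
apply: clim_unique (clim_shift h) _.
apply: (@clim_near _ _ _ _ 0 _ (climD (clim_shift h0) (climZ _ (climJ h1)))) => n _.
rewrite conjc_sum mulr_sumr !big_ord_recl -addrA -big_split; congr (_ + _).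
apply: eq_bigr => j _; rewrite conjcM conjc_real conj_chi opprK mulrCA -chiD.
have -> : nat_of_ord (lift ord0 j) = j.+1 by [].
rewrite /fold ceven /future addr0 /= addrC.
by congr ((c _)%:C * chi _ w + _); lia.
Qed.

Lemma future_recl c M m s w : bounded_coefs c M ->
  fourier (causal (future c m)) w =
  \sum_(v < s) (c (m + v)%N%:Z)%:C * chi (- v%:Z) w
    + chi (- s%:Z) w * fourier (causal (future c (m + s))) w.
Proof.
move=> cM; elim: s => [|s IH].
  by rewrite big_ord0 add0r oppr0 chi0 mul1r addn0.
rewrite IH big_ord_recr/= -addrA; congr (_ + _).
rewrite (fourier_causal_recl w (summable_future _ cM)) mulrDr; congr (_ + _).
  by rewrite mulrC /future add0r.
rewrite mulrA -chiD; congr (chi _ w * fourier (causal _) w); first by lia.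
by apply/funext => v; rewrite /future; congr c; lia.
Qed.

(** Both sides are the series over all integers t of e^(i(t+1)w) c(t - s). It is cut into 0 <= t <
    n, t = -1 - v and t = n + v with v >= 0; in the last range e^(i(n+1)w) = e^(iw). *)
Lemma future_split c M n s k : bounded_coefs c M -> (forall r, c (- r) = c r) ->
  (s < n)%N -> let w : R := frequency n k in
  \sum_(t < n) chi t.+1%:Z w * (c (t%:Z - s%:Z))%:C
    + fourier (causal (future c s.+1)) w
    + expi w * conjc (fourier (causal (future c (n - s))) w) =
  fourier c w * chi s.+1%:Z w.
Proof.
move=> cM ceven sn w; have n0 : (0 < n)%N by lia.
rewrite (fourier_split w cM ceven) (future_recl 0 s.+1 w cM).
rewrite (future_recl 1 (n - s.+1) w cM) add0n.
have -> : (1 + (n - s.+1) = n - s)%N by lia.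
rewrite !conjcD !conjcM conj_chi opprK conjc_sum.
set P1 := fourier (causal (future c s.+1)) w.
set P2 := conjc (fourier (causal (future c (n - s))) w).
set S1 := \sum_(v < s.+1) _; set S2 := \sum_(v < n - s.+1) _.
have c1 : chi (- s.+1%:Z) w * chi s.+1%:Z w = 1 by rewrite -chiD addNr chi0.
have c2 : chi 1 w * chi (n - s.+1)%N%:Z w * chi s.+1%:Z w = expi w.
  by rewrite -(chi_frequencyS k n0) -!chiD; congr chi; lia.
have -> : (S1 + chi (- s.+1%:Z) w * P1 + chi 1 w * (S2 + chi (n - s.+1)%N%:Z w * P2))
    * chi s.+1%:Z w = S1 * chi s.+1%:Z w + chi 1 w * chi s.+1%:Z w * S2 +
    (chi (- s.+1%:Z) w * chi s.+1%:Z w) * P1 +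
    (chi 1 w * chi (n - s.+1)%N%:Z w * chi s.+1%:Z w) * P2 by ring.
rewrite c1 c2 mul1r; congr (_ + _ + _).
rewrite -(big_mkord xpredT (fun t => chi t.+1%:Z w * (c (t%:Z - s%:Z))%:C)).
rewrite (big_cat_nat (n := s.+1))//=; congr (_ + _).
  rewrite big_nat_rev/= big_mkord mulr_suml; apply: eq_bigr => v _.
  have vs := ltn_ord v; rewrite add0n -mulrA -chiD mulrC -ceven.
  by congr ((c _)%:C * chi _ w); lia.
rewrite -[X in \sum_(X <= _ < _) _]add0n big_addn big_mkord mulr_sumr.
apply: eq_bigr => v _; rewrite conjcM conjc_real conj_chi opprK mulrCA.
by rewrite mulrC -!chiD; congr ((c _)%:C * chi _ w); lia.
Qed.

(* By the Yule-Walker equations the full series vanishes, so this is the tail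
   [j > u + n]: the weight lost by not observing X_(n+1), X_(n+2), etc. *)
Definition remainder (a : nat -> R) c n s : nat -> R := fun u =>
  - \sum_(j < (u + n).+1) a j * c (j%:Z - (u + s.+1)%N%:Z).

Lemma sum_rev_le c M m n : bounded_coefs c M -> (n <= m)%N ->
  \sum_(s < n) `|c (m%:Z - s%:Z)| <= M.
Proof.
move=> cM nm; apply: le_trans (sum_shift_le (m - n).+1 n cM).
rewrite -(big_mkord xpredT (fun s => `|c (m%:Z - s%:Z)|)) big_nat_rev/= big_mkord.
apply: ler_sum => s _; rewrite le_eqVlt; apply/orP; left; apply/eqP.
by congr (`|c _|); have := ltn_ord s; lia.
Qed.

Section Remainder.
Context (a : nat -> R) (c : int -> R) (A M : R).
Context (aA : summable_coefs a A) (cM : bounded_coefs c M).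
Context (yw : forall m, (0 < m)%N ->
  (fun N => \sum_(j < N) a j * c (j%:Z - m%:Z)) @ \oo --> (0 : R)).

(** For each j the lags j - u - s - 1 with s < n are distinct, so the sum over s costs only the
    factor M. Subtracting the vanishing full series leaves j > u + n, hence the tail from n + 1 +
    u. *)
Lemma remainder_le n u :
  \sum_(s < n) `|remainder a c n s u| <= M * tail (fun j => `|a j|) (n.+1 + u).
Proof.
have M0 := bounded_sums_ge0 cM.
have : (fun N => \sum_(s < n) `|\sum_(j < N) a j * c (j%:Z - (u + s.+1)%N%:Z) -
   \sum_(j < (u + n).+1) a j * c (j%:Z - (u + s.+1)%N%:Z)|) @ \oo -->
   \sum_(s < n) `|remainder a c n s u|.
  apply: cvg_sum => s; apply: cvg_norm; rewrite /remainder -[X in _ --> X]add0r.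
  by apply: cvgB; [apply: yw; lia|exact: cvg_cst].
move/cvgr_to_le; apply; exists (u + n).+1 => // N /= uN.
have E s : \sum_(j < N) a j * c (j%:Z - (u + s.+1)%N%:Z) -
   \sum_(j < (u + n).+1) a j * c (j%:Z - (u + s.+1)%N%:Z) =
   \sum_((u + n).+1 <= j < N) a j * c (j%:Z - (u + s.+1)%N%:Z).
  by rewrite -!(big_mkord xpredT (fun j => a j * c (j%:Z - (u + s.+1)%N%:Z)))
    (big_cat_nat (n := (u + n).+1))//= addrAC subrr add0r.
apply: le_trans (_ : \sum_(s < n) \sum_((u + n).+1 <= j < N)
    `|a j| * `|c (j%:Z - (u + s.+1)%N%:Z)| <= _).
  apply: ler_sum => s _; rewrite E (le_trans (ler_norm_sum _ _ _))//.
  by apply: ler_sum => j _; rewrite normrM.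
rewrite exchange_big/=.
have -> : (n.+1 + u = (u + n).+1)%N by lia.
apply: le_trans (_ : M * \sum_((u + n).+1 <= j < N) `|a j| <= _); last first.
  by rewrite ler_wpM2l// -(sum_tail_le (fun j => `|a j|) uN) (tail_ge aA).
rewrite mulr_sumr; apply: ler_sum_nat => j /andP[uj _].
rewrite -mulr_sumr mulrC ler_wpM2r//.
apply: le_trans (sum_rev_le (m := (j - u.+1)%N) (n := n) cM _); last by lia.
apply: ler_sum => s _; rewrite le_eqVlt; apply/orP; left; apply/eqP.
by congr (`|c _|); lia.
Qed.

Lemma remainder_bounds n S :
  (forall P, \sum_(n.+1 <= j < P) j%:R * `|a j| <= S) ->
  exists X : nat -> R, (forall s, (s < n)%N -> summable_coefs (remainder a c n s) (X s)) /\
    \sum_(s < n) X s <= M * S.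
Proof.
move=> aS; have M0 := bounded_sums_ge0 cM.
have tot U : \sum_(s < n) \sum_(u < U) `|remainder a c n s u| <= M * S.
  rewrite exchange_big/= (le_trans (ler_sum _ (fun (u : 'I_U) _ => remainder_le n u)))//.
  by rewrite -mulr_sumr ler_wpM2l// (sum_tail_weighted _ _ aA).
(* The exact l^1 norm of each remainder is kept: using the bound M * S for each s would give n M S
   after summation. *)
pose X s := limn (fun U => \sum_(u < U) `|remainder a c n s u|).
have rb s : (s < n)%N -> bounded_sums (fun u => `|remainder a c n s u|) (M * S).
  move=> sn; split => // U; apply: le_trans (tot U).
  by rewrite (bigD1 (Ordinal sn))//= lerDl sumr_ge0// => t _; exact: sumr_ge0.
exists X; split => [s sn|].
  split => // U; apply: (@nondecreasing_cvgn_le _ (fun U => \sum_(u < U) `|remainder a c n s u|)).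
    exact: nondecreasing_sums (rb s sn).1.
  exact: bounded_sums_cvg (rb s sn).
have : (fun U => \sum_(s < n) \sum_(u < U) `|remainder a c n s u|) @ \oo --> \sum_(s < n) X s.
  by apply: cvg_sum => s; exact: bounded_sums_cvg (rb s (ltn_ord s)).
by move/cvgr_to_le; apply; exact: nearW.
Qed.

(** With j = t + 1 + u, every term is a_j c(j - (u + s + 1)) up to sign: the left side has u < j <=
    u + n, the remainder 0 <= j <= u + n, and evenness of c identifies the terms j <= u with the
    convolution. *)
Lemma sum_prediction n s u : (forall r, c (- r) = c r) ->
  \sum_(t < n) - a (t.+1 + u)%N * c (t%:Z - s%:Z) =
  conv_seq a (future c s.+1) u + remainder a c n s u.
Proof.
move=> ceven; rewrite /remainder /conv_seq.
rewrite -(big_mkord xpredT (fun j => a j * c (j%:Z - (u + s.+1)%N%:Z))).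
rewrite (big_cat_nat (n := u.+1))//= ?ltnS ?leq_addr// opprD addrA.
rewrite big_mkord -sumrB [X in _ = X - _]big1 ?sub0r => [|j _]; last first.
  rewrite /future -ceven; apply/eqP; rewrite subr_eq0; apply/eqP.
  by congr (_ * c _); have := ltn_ord j; lia.
rewrite -[X in \sum_(X <= _ < _) _]add0n big_addn.
have -> : ((u + n).+1 - u.+1 = n)%N by lia.
rewrite big_mkord -sumrN; apply: eq_bigr => t _; rewrite mulNr.
by congr (- (a _ * c _)); lia.
Qed.

End Remainder.
End Prediction.

Lemma sum_mul_split (L : fieldType) (I : finType) (x y z k : I -> L) (e p q : L) :
  \sum_t (x t + (y t / p + e * (z t / q))) * k t =
  \sum_t x t * k t + (\sum_t y t * k t) / p + e * ((\sum_t z t * k t) / q).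
Proof.
rewrite !mulr_suml mulr_sumr -!big_split; apply: eq_bigr => t _ /=; ring.
Qed.

Lemma sum_rev_ord (R : realType) n (G : nat -> R) :
  \sum_(t < n) G (rev_ord t) = \sum_(t < n) G t.
Proof. by rewrite [RHS](reindex_inj rev_ord_inj). Qed.

(** * The approximate inverse of the covariance matrix *)

Section MatrixBounds.
Context {R : realType} (K : R) (f : R -> R) (c : int -> R) (F : canonical_factor R)
  (K1 : 1 < K) (fc : spectral_density f c) (fF : canonical_factorisation f F)
  (cK : summable [set: int] (fun r : int => (`|r%:~R : R| `^ K * c r)%:E)).
Implicit Types (n : nat) (w : R) (x y : nat -> R).

Let a := phi_seq F.
Let s2 := sigma F ^- 2.

Lemma invsigma2_gt0 : 0 < s2.
Proof. by rewrite invr_gt0 (sigma2_gt0 fF). Qed.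

(** The shape shared by the columns of [D_inf], up to n^(-1/2), and by the symbols of the error
    columns in [approx_inverseP], so that one norm estimate serves both. *)
Definition two_sided x y w : R[i] :=
  fourier (causal x) w / phi F w + expi w * (conjc (fourier (causal y) w) / conjc (phi F w)).

Lemma dft_norm_two_sided n A x y X Y : (0 < n)%N -> summable_coefs a A ->
  summable_coefs x X -> summable_coefs y Y ->
  dft_norm n (fun w => ((f w)^-1)%:C * two_sided x y w) <= s2 * (A * (X + Y)).
Proof.
move=> n0 aA xX yY.
rewrite (@eq_dft_norm _ n _ (fun w => s2%:C *
   (conjc (fourier (causal a) w) * fourier (causal x) w +
    fourier (causal a) w * (chi 1 w * conjc (fourier (causal y) w))))); last first.
  move=> k kn; set w := frequency n k.+1.
  have wI : w \in `[0, 2 * pi] by exact: frequency_itv.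
  have p0 := phi_neq0 fc fF wI.
  have pJ0 : conjc (phi F w) != 0 by rewrite conjc_eq0.
  rewrite (invf_phi fF wI) /two_sided chi1 -/(phi F w) -mulrA; congr (_ * _).
  by field; rewrite p0 pJ0.
rewrite dft_normZ cmodR gtr0_norm ?invsigma2_gt0// ler_pM2l ?invsigma2_gt0//.
rewrite (le_trans (dft_normD _ _ _))// mulrDr lerD//.
  apply: wiener_dft_norm; rewrite -[X]mulr1; apply: wiener_causalJ aA _ => // m.
  rewrite (@eq_dft_norm _ n _ (fun w => chi m w * (fourier (causal x) w * 1))).
    by apply: wiener_causal xX _ m => //; exact: wiener_cst.
  by move=> k _; rewrite mulr1.
apply: wiener_dft_norm; rewrite -[Y]mulr1; apply: wiener_causal aA _ => //.
apply: wiener_chiM => m.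
rewrite (@eq_dft_norm _ n _ (fun w => chi m w * (conjc (fourier (causal y) w) * 1))).
  by apply: wiener_causalJ yY _ m => //; exact: wiener_cst.
by move=> k _; rewrite mulr1.
Qed.

Definition predictor t : nat -> R := fun s => ar F (t.+1 + s).

Lemma summable_predictor A t : summable_coefs a A ->
  summable_coefs (predictor t) (tail (fun j => `|a j|) t.+1).
Proof.
move=> aA; have [h1 h2] := shift_sums t.+1 aA; split=> // N.
apply: le_trans (h2 N); apply: ler_sum => j _.
by rewrite /predictor /a /phi_seq addSn /= normrN.
Qed.

(** With columns numbered from 0, the index n + 1 - (t + 1) equals (n - 1 - t) + 1, so the second
    half is the predictor of the reversed column. *)
Lemma D_infE n k (t : 'I_n) : D_inf n F k t =
  (Num.sqrt n%:R)^-1%:C *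
    two_sided (predictor t) (predictor (rev_ord t)) (frequency n k.+1).
Proof.
rewrite mxE /two_sided /phi_inf mulrDr; congr (_ + _).
rewrite -[LHS]mulrA; congr (_ * (_ * (conjc (fourier (causal _) _) / _))).
apply/funext => s; rewrite /predictor /=.
by congr (ar F _); have := ltn_ord t; lia.
Qed.

Lemma D_inf_le n A S : (0 < n)%N -> summable_coefs a A ->
  (forall P, \sum_(1 <= j < P) j%:R * `|a j| <= S) ->
  mxnorm1 (adjoint (DFT n) *m Delta n (fun w => (f w)^-1) *m D_inf n F)
    <= 2 * s2 * A * S.
Proof.
move=> n0 aA aS; have A0 := bounded_sums_ge0 aA.
pose T t := tail (fun j => `|a j|) t.+1.
rewrite /mxnorm1 exchange_big/=.
apply: le_trans (_ : \sum_(t < n) s2 * (A * (T t + T (rev_ord t))) <= _).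
  apply: ler_sum => t _.
  apply: le_trans (dft_norm_two_sided n0 aA (summable_predictor t aA)
    (summable_predictor (rev_ord t) aA)).
  apply: ler_sum => s _; rewrite (@adjoint_DFT_entry _ n n _ _
    (two_sided (predictor t) (predictor (rev_ord t)))) => // k.
  exact: D_infE.
(* Reversal permutes the columns, so both halves of D_oo receive the same bound; hence the factor
   2. *)
rewrite -!mulr_sumr big_split/= (sum_rev_ord n T).
have TS : \sum_(t < n) T t <= S := (@sum_tail_weighted _ _ _ _ 1 n isT aA aS).
have -> : s2 * (A * (\sum_(t < n) T t + \sum_(t < n) T t)) =
    2 * s2 * A * \sum_(t < n) T t by ring.
by rewrite ler_wpM2l// !mulr_ge0// ltW// invsigma2_gt0.
Qed.

Definition approx_inverse n : 'M[R[i]]_n :=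
  adjoint (DFT n) *m Delta n (fun w => (f w)^-1) *m (DFT n + D_inf n F).

(** By [sum_prediction], the predictors summed against column s of Gamma give phi times a future
    series plus a remainder. Division by phi lets [future_split] rebuild f(w) e^(i(s+1)w); then 1/f
    cancels f, and orthogonality of characters yields the identity matrix. *)
Lemma approx_inverseP n A M S : (0 < n)%N -> summable_coefs a A -> bounded_coefs c M ->
  (forall P, \sum_(n.+1 <= j < P) j%:R * `|a j| <= S) ->
  exists E : 'M[R[i]]_n,
    approx_inverse n *m map_mx (real_complex R) (Gamma n c) = 1%:M + E /\
    mxnorm1 E <= 2 * s2 * A * (M * S).
Proof.
move=> n0 aA cM aS; have [_ _ ceven fE] := fc.
have A0 := bounded_sums_ge0 aA.
have [X [rX XS]] := remainder_bounds aA cM (fun m => @yule_walker0 _ _ _ _ _ K1 fc fF cK m) aS.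
pose d (t : 'I_n) w := chi t.+1%:Z w + two_sided (predictor t) (predictor (rev_ord t)) w.
pose r (s : 'I_n) := remainder a c n s.
exists (\matrix_(i, s) avg n i.+1%:Z (fun w => ((f w)^-1)%:C * two_sided (r s) (r (rev_ord s)) w)).
have dE (s : 'I_n) k : (k < n)%N -> let w : R := frequency n k.+1 in
    \sum_(t < n) d t w * (c (t%:Z - s%:Z))%:C =
    (f w)%:C * chi s.+1%:Z w + two_sided (r s) (r (rev_ord s)) w.
  move=> kn w; have wI : w \in `[0, 2 * pi] by exact: frequency_itv.
  have P (q : 'I_n) : \sum_(t < n) fourier (causal (predictor t)) w * (c (t%:Z - q%:Z))%:C =
      phi F w * fourier (causal (future c q.+1)) w + fourier (causal (r q)) w.
    have sM := summable_conv aA (summable_future q.+1 cM).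
    have eqx : (fun u => \sum_(t < n) predictor t u * c (t%:Z - q%:Z)) =
        (fun u => conv_seq a (future c q.+1) u + r q u).
      apply/funext => u; rewrite -(sum_prediction a n q u ceven).
      by apply: eq_bigr => t _; rewrite /a /phi_seq addSn /= opprK.
    rewrite (@fourier_causal_sum _ _ _ _ _ _ w (A * M + X q)
      (fun t : 'I_n => summable_predictor t aA)).
      rewrite eqx (fourier_causalD w sM (rX q (ltn_ord q))).
      by rewrite (fourier_conv w aA (summable_future _ cM)).
    rewrite eqx; split => // N.
    rewrite (le_trans _ (lerD (sM.2 N) ((rX q (ltn_ord q)).2 N)))// -big_split.
    by apply: ler_sum => j _; exact: ler_normD.
  (* The predictions beyond time n are those before time 1 for the reversed sample, because c is
     even. *)
  have Pr : \sum_(t < n) conjc (fourier (causal (predictor (rev_ord t))) w) * (c (t%:Z - s%:Z))%:C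
     = conjc (phi F w) * conjc (fourier (causal (future c (n - s))) w)
       + conjc (fourier (causal (r (rev_ord s))) w).
    have ns : (rev_ord s).+1 = (n - s)%N by rewrite /=; have := ltn_ord s; lia.
    rewrite -conjcM -conjcD -ns -P conjc_sum (reindex_inj rev_ord_inj).
    apply: eq_bigr => t _; rewrite conjcM conjc_real rev_ordK -ceven.
    by congr (_ * (c _)%:C); rewrite /=; have := ltn_ord s; have := ltn_ord t; lia.
  have p0 := phi_neq0 fc fF wI.
  have pJ0 : conjc (phi F w) != 0 by rewrite conjc_eq0.
  rewrite fE// -(future_split k.+1 cM ceven (ltn_ord s)) -/w /two_sided.
  transitivity (\sum_(t < n) chi t.+1%:Z w * (c (t%:Z - s%:Z))%:C +
     (\sum_(t < n) fourier (causal (predictor t)) w * (c (t%:Z - s%:Z))%:C) / phi F w +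
     expi w * ((\sum_(t < n) conjc (fourier (causal (predictor (rev_ord t))) w) *
         (c (t%:Z - s%:Z))%:C)
       / conjc (phi F w))).
    exact: sum_mul_split.
  by rewrite P Pr; field; rewrite p0 pJ0.
have LE i (s : 'I_n) : (approx_inverse n *m map_mx (real_complex R) (Gamma n c)) i s =
    avg n i.+1%:Z (fun w => ((f w)^-1)%:C * \sum_(t < n) d t w * (c (t%:Z - s%:Z))%:C).
  rewrite mxE; transitivity (\sum_(t < n) (c (t%:Z - s%:Z))%:C *
      avg n i.+1%:Z (fun w => ((f w)^-1)%:C * d t w)).
    apply: eq_bigr => t _; rewrite mulrC; congr (_ * _); first by rewrite !mxE.
    rewrite /approx_inverse (@adjoint_DFT_entry _ n n _ _ (d t)) => // k.
    transitivity (DFT n k t + D_inf n F k t); first by rewrite mxE.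
    by rewrite D_infE /d [RHS]mulrDr; congr (_ + _); rewrite mxE.
  under eq_bigr do rewrite -avgZ; rewrite -avg_sum; apply: eq_avg => k kn.
  by rewrite mulr_sumr; apply: eq_bigr => t _; ring.
split.
  apply/matrixP => i s; rewrite LE !mxE.
  transitivity (avg n i.+1%:Z (fun w => chi s.+1%:Z w +
      ((f w)^-1)%:C * two_sided (r s) (r (rev_ord s)) w)).
    apply: eq_avg => k kn; rewrite dE// mulrDr mulrA -real_complexM mulVf ?mul1r//.
    by have [f0 _ _ _] := fc; rewrite gt_eqF// f0// frequency_itv.
  rewrite avgD avg_chi//; congr (_ + _).
  rewrite -val_eqE /=; have := ltn_ord i; have := ltn_ord s => si ii.
  case: eqP => [->|ne]; first by rewrite subrr dvdz0.
  by rewrite dvdz_small; [case: eqP => //; lia | clear -si ii; lia].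
rewrite /mxnorm1 exchange_big/=.
apply: le_trans (_ : \sum_(s < n) s2 * (A * (X s + X (rev_ord s))) <= _).
  apply: ler_sum => s _.
  apply: le_trans (dft_norm_two_sided n0 aA (rX s (ltn_ord s)) (rX _ (ltn_ord (rev_ord s)))).
  by apply: ler_sum => i _; rewrite mxE.
rewrite -!mulr_sumr big_split/= (sum_rev_ord n X).
have -> : s2 * (A * (\sum_(t < n) X t + \sum_(t < n) X t)) =
    2 * s2 * A * \sum_(t < n) X t by ring.
by rewrite ler_wpM2l// !mulr_ge0// ltW// invsigma2_gt0.
Qed.

End MatrixBounds.

(** * Positive definiteness and invertibility of the covariance matrix *)

Section PositiveDefinite.
Context {R : realType}.
Implicit Types (h : R -> R[i]) (d c : int -> R).

Lemma clim_quadratic n h d (x : 'I_n -> R) :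
  (forall s, clim (fun N => avg N s h) (d s)%:C) ->
  clim (fun N => avg N 0 (fun w => h w *
      (cmod (\sum_t (x t)%:C * chi (t : nat)%:Z w) ^+ 2)%:C))
    (\sum_s \sum_t x s * x t * d ((s : nat)%:Z - (t : nat)%:Z))%:C.
Proof.
move=> hd; rewrite real_complex_sum.
under [X in clim _ X]eq_bigr do rewrite real_complex_sum.
have c (s t : 'I_n) : clim (fun N => (x s * x t)%:C * avg N (s%:Z - t%:Z) h)
    (x s * x t * d (s%:Z - t%:Z))%:C.
  by rewrite (real_complexM (x s * x t)); exact: climZ (hd _).
apply: (@clim_near _ _ _ _ 0 _ (clim_sum _ (fun s => clim_sum _ (fun t => c s t)))) => N _.
have E (s t : 'I_n) : (x s * x t)%:C * avg N (s%:Z - t%:Z) h =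
    avg N 0 (fun w => (x s * x t)%:C * (chi (t%:Z - s%:Z) w * h w)).
  by rewrite avgZ avg_shift sub0r opprB.
under eq_bigr do under eq_bigr do rewrite E.
under eq_bigr do rewrite -avg_sum.
rewrite -avg_sum; apply: eq_avg => k _; set w := frequency _ _.
rewrite -mulJc conjc_sum mulr_suml mulr_sumr; apply: eq_bigr => s _.
rewrite !mulr_sumr; apply: eq_bigr => t _.
rewrite conjcM conjc_real conj_chi chiD real_complexM; ring.
Qed.

(** The quadratic limit is taken with h = f - delta >= 0, whose coefficients are those of c with
    delta subtracted at 0: all averages are nonnegative, hence so is the limit. *)
Lemma quadratic_ge0 n f c M (delta : R) (x : 'I_n -> R) :
  bounded_coefs c M ->
  (forall w, w \in `[0, 2 * pi] -> (f w)%:C = fourier c w) ->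
  (forall w, w \in `[0, 2 * pi] -> delta <= f w) ->
  delta * \sum_t x t ^+ 2 <=
    \sum_s \sum_t x s * x t * c ((s : nat)%:Z - (t : nat)%:Z).
Proof.
move=> cM fE fd; rewrite -subr_ge0.
pose X w := cmod (\sum_t (x t)%:C * chi (t : nat)%:Z w) ^+ 2.
pose u N := N%:R^-1 * \sum_(k < N) (f (frequency N k.+1) - delta) * X (frequency N k.+1).
have hd s : clim (fun N => avg N s (fun w => (f w - delta)%:C)) (c s - delta * (s == 0)%:R)%:C.
  rewrite -mulNr real_complexD real_complexM.
  apply: (@clim_near _ _ _ _ 0 _ (climD (clim_avg_fourier s cM)
    (climZ (- delta)%:C (clim_avg1 s)))) => N _.
  rewrite -avgZ -avgD; apply: eq_avg => k kN.
  by rewrite real_complexD fE ?frequency_itv// chi0 mulr1.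
have := clim_quadratic x hd.
have -> : \sum_s \sum_t x s * x t * (c ((s : nat)%:Z - (t : nat)%:Z) -
    delta * ((s : nat)%:Z - (t : nat)%:Z == 0)%:R) =
   \sum_s \sum_t x s * x t * c ((s : nat)%:Z - (t : nat)%:Z) - delta * \sum_t x t ^+ 2.
  rewrite mulr_sumr -sumrB; apply: eq_bigr => s _.
  under eq_bigr do rewrite mulrBr; rewrite sumrB; congr (_ - _).
  rewrite (bigD1 s)//= subrr eqxx big1 ?addr0/=; first by ring.
  move=> t ts; rewrite subr_eq0 eqz_nat eq_sym val_eqE (negbTE ts)/=; ring.
move=> cu; have : u @ \oo --> \sum_s \sum_t x s * x t * c ((s : nat)%:Z - (t : nat)%:Z)
    - delta * \sum_t x t ^+ 2.
  apply: clim_cvg; apply: (@clim_near _ _ _ _ 0 _ cu) => N _.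
  rewrite /u /avg real_complexM real_complex_sum; congr (_ * _).
  by apply: eq_bigr => k _; rewrite oppr0 chi0 mul1r [in RHS]real_complexM.
move/cvgr_to_ge; apply; apply: nearW => N; rewrite mulr_ge0// sumr_ge0// => k _.
by rewrite mulr_ge0 ?sqr_ge0// subr_ge0 fd// frequency_itv.
Qed.

(** A row vector killed by Gamma makes the quadratic form vanish, which forces it to be 0. On a
    singular matrix [invmx] would return its argument and not an inverse. *)
Lemma Gamma_unit n f c M (delta : R) :
  0 < delta -> bounded_coefs c M ->
  (forall w, w \in `[0, 2 * pi] -> (f w)%:C = fourier c w) ->
  (forall w, w \in `[0, 2 * pi] -> delta <= f w) ->
  Gamma n c \in unitmx.
Proof.
move=> d0 cM fE fd; rewrite -row_free_unit -kermx_eq0; apply/rowV0P => v.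
move/sub_kermxP => vG; have := quadratic_ge0 (fun i => v 0 i) cM fE fd.
rewrite exchange_big [X in _ <= X]big1/= => [|t _]; last first.
  rewrite (_ : \sum_i _ = (v *m Gamma n c) 0 t * v 0 t).
    by rewrite vG mxE mul0r.
  by rewrite mxE mulr_suml; apply: eq_bigr => s _; rewrite mxE; ring.
rewrite pmulr_rle0// => h; apply/rowP => i; rewrite mxE; apply/eqP.
have s0 : \sum_t v 0 t ^+ 2 = 0 by apply/le_anti; rewrite h sumr_ge0// => t _; exact: sqr_ge0.
move: s0 => /eqP; rewrite psumr_eq0 => [/allP/(_ i)|t _]; last exact: sqr_ge0.
by rewrite mem_index_enum /= sqrf_eq0; apply.
Qed.

Lemma Gamma_sym n c : (forall r, c (- r) = c r) -> (Gamma n c)^T = Gamma n c.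
Proof.
by move=> ce; apply/matrixP => i j; rewrite !mxE -ce opprB.
Qed.

End PositiveDefinite.

(** * Entrywise norm, row sums and column sums *)

Section MatrixNorm.
Context {R : realType}.

Lemma mxnorm1_ge0 m n (A : 'M[R[i]]_(m, n)) : 0 <= mxnorm1 A.
Proof. by apply: sumr_ge0 => i _; apply: sumr_ge0 => j _; exact: cmod_ge0. Qed.

Lemma mxnorm1B m n (A B : 'M[R[i]]_(m, n)) : mxnorm1 (A - B) <= mxnorm1 A + mxnorm1 B.
Proof.
rewrite /mxnorm1 -big_split; apply: ler_sum => i _ /=.
rewrite -big_split; apply: ler_sum => j _ /=.
by rewrite !mxE (le_trans (le_normcD _ _))// normcN.
Qed.

Lemma mxnorm1M m n p (A : 'M[R[i]]_(m, n)) (B : 'M[R[i]]_(n, p)) (H : R) :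
  (forall i, \sum_j cmod (B i j) <= H) -> mxnorm1 (A *m B) <= mxnorm1 A * H.
Proof.
move=> BH; rewrite /mxnorm1 mulr_suml; apply: ler_sum => i _.
apply: le_trans (_ : \sum_j \sum_k cmod (A i k) * cmod (B k j) <= _).
  apply: ler_sum => j _; rewrite mxE (le_trans (cmod_sum _ _ _))//.
  by apply: ler_sum => k _; rewrite Normc.normcM.
rewrite exchange_big mulr_suml; apply: ler_sum => k _ /=.
by rewrite -mulr_sumr ler_wpM2l ?cmod_ge0.
Qed.

(** Serves to bound Gamma^-1 itself, column by column; the final estimate of E Gamma^-1 uses
    [mxnorm1M] with row sums instead. *)
Lemma col_sumM_le m n p (A : 'M[R[i]]_(m, n)) (B : 'M[R[i]]_(n, p)) j :
  \sum_i cmod ((A *m B) i j) <= mxnorm1 A * \sum_k cmod (B k j).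
Proof.
rewrite /mxnorm1 mulr_suml; apply: ler_sum => i _.
rewrite mxE (le_trans (cmod_sum _ _ _))// mulr_suml; apply: ler_sum => k _.
rewrite Normc.normcM ler_wpM2l ?cmod_ge0// (bigD1 k)//= lerDl sumr_ge0// => l _.
exact: cmod_ge0.
Qed.

Lemma row_sum_le m n (A : 'M[R[i]]_(m, n)) i : \sum_j cmod (A i j) <= mxnorm1 A.
Proof.
rewrite /mxnorm1 [leRHS](bigD1 i)//= lerDl sumr_ge0// => k _.
by apply: sumr_ge0 => *; exact: cmod_ge0.
Qed.

Lemma col_sum_le m n (A : 'M[R[i]]_(m, n)) j : \sum_i cmod (A i j) <= mxnorm1 A.
Proof.
rewrite /mxnorm1; apply: ler_sum => i _; rewrite [leRHS](bigD1 j)//= lerDl.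
by apply: sumr_ge0 => *; exact: cmod_ge0.
Qed.

Lemma inverse_split n (L E : 'M[R[i]]_n) (B : 'M[R]_n) : B \in unitmx ->
  L *m map_mx (real_complex R) B = 1%:M + E ->
  map_mx (real_complex R) (invmx B) = L - E *m map_mx (real_complex R) (invmx B).
Proof.
move=> Bu LE; apply/eqP; rewrite eq_sym subr_eq; apply/eqP.
rewrite -[LHS]mulmx1 -(map_mx1 (real_complex R)) -(mulmxV Bu) map_mxM mulmxA LE.
by rewrite mulmxDl mul1mx.
Qed.

End MatrixNorm.

(** * Moments of quadratic forms *)

Section LnormBounds.
Context (R : realType) (d : measure_display) (T : measurableType d) (P : probability T R).
Local Open Scope ereal_scope.
Implicit Types (q : R) (X Y g : T -> R).

Let measurable_norm_powR X (q : R) : measurable_fun [set: T] X ->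
  measurable_fun [set: T] (fun o => (`|X o| `^ q)%R).
Proof.
move=> mX; apply: (measurableT_comp (measurable_powR q)).
exact: (measurableT_comp (@normr_measurable R setT)).
Qed.

Lemma Lnorm_le_poweR q X (V : \bar R) : (0 < q)%R -> 0 <= V ->
  \int[P]_o (`|X o| `^ q)%:E <= V -> 'N[P]_(q%:E)[EFin \o X] <= V `^ q^-1.
Proof.
move=> q0 V0 XV; rewrite unlock /Lnorm; apply: gt0_ler_poweR; rewrite ?invr_ge0 ?(ltW q0)//.
  by rewrite in_itv /= leey andbT; apply: integral_ge0 => o _; rewrite lee_fin powR_ge0.
by rewrite in_itv /= leey andbT.
Qed.

(* Monotonicity needs no measurability: the integral of a nonnegative function is
   a supremum over the simple functions below it. *)
Lemma Lnorm_mono q X Y : (0 < q)%R -> (forall o, `|X o| <= `|Y o|)%R ->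
  'N[P]_(q%:E)[EFin \o X] <= 'N[P]_(q%:E)[EFin \o Y].
Proof.
move=> q0 XY; rewrite unlock /Lnorm.
apply: gt0_ler_poweR; rewrite ?invr_ge0 ?(ltW q0)//.
- by rewrite in_itv /= leey andbT; apply: integral_ge0 => o _; rewrite lee_fin powR_ge0.
- by rewrite in_itv /= leey andbT; apply: integral_ge0 => o _; rewrite lee_fin powR_ge0.
have h o : `|(EFin \o X) o| `^ q <= `|(EFin \o Y) o| `^ q.
  by rewrite /= lee_fin ge0_ler_powR ?nnegrE ?(ltW q0).
rewrite !ge0_integralTE => [|o|o]; try exact: poweR_ge0.
apply: le_ereal_sup => _ [s hs <-]; exists s => // o.
exact: le_trans (hs o) (h o).
Qed.

Lemma Lnorm_scale q (k : R) X : (0 < q)%R -> (0 <= k)%R -> measurable_fun [set: T] X ->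
  'N[P]_(q%:E)[EFin \o (fun o => (k * X o)%R)] = k%:E * 'N[P]_(q%:E)[EFin \o X].
Proof.
move=> q0 k0 mX; rewrite unlock /Lnorm.
transitivity (((k `^ q)%:E * \int[P]_o (`|X o| `^ q)%:E) `^ q^-1); last first.
  rewrite poweRM ?lee_fin ?powR_ge0//; last by apply: integral_ge0 => o _; rewrite lee_fin powR_ge0.
  rewrite poweR_EFin -powRrM mulfV ?gt_eqF// powRr1//.
rewrite -ge0_integralZl_EFin ?powR_ge0//; first last.
  by apply/measurable_EFinP; exact: measurable_norm_powR.
congr (_ `^ _); apply: eq_integral => o _.
by rewrite /= normrM powRM// ger0_norm.
Qed.

(** Cauchy-Schwarz for |X|^q and |Y|^q, followed by a q-th root. *)
Lemma Lnorm_mul_le q X Y : (0 < q)%R -> measurable_fun [set: T] X ->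
  measurable_fun [set: T] Y ->
  'N[P]_(q%:E)[EFin \o (fun o => (X o * Y o)%R)] <=
    'N[P]_((2 * q)%:E)[EFin \o X] * 'N[P]_((2 * q)%:E)[EFin \o Y].
Proof.
move=> q0 mX mY; have q20 : (2 * q != 0)%R by rewrite mulf_neq0 ?gt_eqF.
have N2 Z : 'N[P]_(2%:E)[EFin \o (fun o => `|Z o| `^ q)%R] =
    'N[P]_((2 * q)%:E)[EFin \o Z] `^ q.
  transitivity (('N[P]_((2 * q)%:E)[EFin \o Z] `^ (2 * q)) `^ 2^-1); last first.
    by rewrite -poweRrM mulrAC mulfV ?mul1r.
  rewrite poweR_Lnorm// unlock /Lnorm; congr (_ `^ _); apply: eq_integral => o _.
  by rewrite /= ger0_norm ?powR_ge0// -powRrM mulrC.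
have h2 : (2^-1 + 2^-1 = 1 :> R)%R by rewrite [RHS]splitr div1r.
have := hoelder P (measurable_norm_powR q mX) (measurable_norm_powR q mY)
  (ltr0Sn _ 1) (ltr0Sn _ 1) h2.
rewrite !N2 Lnorm1 -poweRM ?Lnorm_ge0// => h.
set N := leRHS; have N0 : 0 <= N by rewrite mule_ge0// Lnorm_ge0.
have -> : N = (N `^ q) `^ q^-1 by rewrite -poweRrM mulfV ?gt_eqF// poweRe1.
apply: Lnorm_le_poweR; rewrite ?poweR_ge0//.
apply: le_trans h; rewrite le_eqVlt; apply/orP; left; apply/eqP.
apply: eq_integral => o _; rewrite /= normrM powRM//.
by rewrite [in RHS]ger0_norm// mulr_ge0 ?powR_ge0.
Qed.

Lemma Lnorm_sum_le q (I : Type) (r : seq I) (X : I -> T -> R) (M : I -> \bar R) :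
  (1 <= q)%R -> (forall i, measurable_fun [set: T] (X i)) ->
  (forall i, 'N[P]_(q%:E)[EFin \o X i] <= M i) ->
  'N[P]_(q%:E)[EFin \o (fun o => \sum_(i <- r) X i o)%R] <= \sum_(i <- r) M i.
Proof.
move=> q1 mX XM; elim: r => [|i r IH].
  rewrite big_nil (eq_Lnorm _ _ (g := cst 0)); last by move=> o /=; rewrite big_nil.
  by rewrite Lnorm0// eqe gt_eqF// (lt_le_trans _ q1).
rewrite big_cons (eq_Lnorm _ _ (g := EFin \o (X i \+ (fun o => \sum_(i <- r) X i o)%R)%R)).
  rewrite (le_trans (minkowski_EFin _ _ _ _))//; first exact: measurable_sum.
  by rewrite leeD.
by move=> o /=; rewrite big_cons.
Qed.

End LnormBounds.

Lemma quadratic_form_le (R : realType) n (G : 'M[R]_n) (C : 'M[R[i]]_n) (x : 'cV[R]_n) :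
  let z := map_mx (real_complex R) x in
  cmod (((x^T *m G *m x) 0 0)%:C - (z^T *m C *m z) 0 0) <=
  \sum_s \sum_t cmod ((map_mx (real_complex R) G - C) s t) * `|x s 0 * x t 0|.
Proof.
rewrite /=; set z := map_mx _ x; set V := _ - C.
have -> : ((x^T *m G *m x) 0 0)%:C - (z^T *m C *m z) 0 0 = (z^T *m V *m z) 0 0.
  have E (A B : 'M[R[i]]_1) : (A - B) 0 0 = A 0 0 - B 0 0 by rewrite !mxE.
  rewrite /V mulmxBr mulmxBl E; congr (_ - _).
  have -> : z^T = map_mx (real_complex R) x^T by apply/matrixP => i j; rewrite !mxE.
  by rewrite -!map_mxM [RHS]mxE.
rewrite mxE (le_trans (cmod_sum _ _ _))// exchange_big/=; apply: ler_sum => t _.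
rewrite mxE mulr_suml (le_trans (cmod_sum _ _ _))//; apply: ler_sum => s _.
rewrite !Normc.normcM !mxE !cmodR normrM le_eqVlt; apply/orP; left; apply/eqP; ring.
Qed.

Lemma likelihood_Lnorm (R : realType) (f : R -> R) (c : int -> R) (n : nat) (B q : R)
    (d : measure_display) (T : measurableType d) (P : probability T R)
    (X : int -> {RV P >-> R}) :
  mxnorm1 (map_mx (real_complex R) (invmx (Gamma n c))
    - circulant n (fun w => (f w)^-1)) <= B ->
  1 < q -> (sup_norm (2 * q) X < +oo)%E ->
  ('N[P]_(q%:E)[(fun o => (cmod ((gaussian_likelihood c (sample X n o))%:C
       - whittle_likelihood f (sample X n o)))%:E)]
    <= (n%:R^-1 * B)%:E * sup_norm (2 * q) X ^+ 2)%E.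
Proof.
set V := _ - _ => VB q1 Sfin; have q0 : 0 < q by rewrite (lt_trans _ q1).
pose m (s t : 'I_n) := n%:R^-1 * cmod (V s t).
have m0 s t : 0 <= m s t by rewrite mulr_ge0 ?invr_ge0// cmod_ge0.
pose x (s : 'I_n) := X s.+1%:Z : T -> R.
have mx s : measurable_fun [set: T] (x s) by [].
have mxx s t : measurable_fun [set: T] (fun o => `|x s o * x t o|).
  by apply: (measurableT_comp (@normr_measurable R setT)); exact: measurable_funM.
pose Y s t o := m s t * `|x s o * x t o|.
have mY s t : measurable_fun [set: T] (Y s t).
  by apply: measurable_funM => //; exact: measurable_cst.
have S0 : (0 <= sup_norm (2 * q) X)%E.
  by apply: le_trans (ereal_sup_ubound _); [|by exists 0]; exact: Lnorm_ge0.
have xS s : ('N[P]_((2 * q)%:E)[EFin \o x s] <= sup_norm (2 * q) X)%E.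
  by apply: ereal_sup_ubound; exists s.+1%:Z.
have Sf : sup_norm (2 * q) X \is a fin_num by rewrite ge0_fin_numE.
set S := sup_norm (2 * q) X in S0 xS Sf *.
have YS s t : ('N[P]_(q%:E)[EFin \o Y s t] <= (m s t)%:E * (S * S))%E.
  rewrite Lnorm_scale// lee_wpmul2l ?lee_fin//.
  apply: le_trans (_ : 'N[P]_(q%:E)[EFin \o (fun o => (x s o * x t o)%R)] <= _)%E.
    by apply: Lnorm_mono => // o; rewrite normr_id.
  by rewrite (le_trans (Lnorm_mul_le _ q0 (mx s) (mx t)))// lee_pmul// Lnorm_ge0.
pose Z o := \sum_s \sum_t Y s t o.
have ptw o : cmod ((gaussian_likelihood c (sample X n o))%:C
    - whittle_likelihood f (sample X n o)) <= Z o.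
  rewrite /gaussian_likelihood /whittle_likelihood real_complexM -mulrBr.
  rewrite Normc.normcM cmodR ger0_norm ?invr_ge0// /Z.
  under eq_bigr do under eq_bigr do rewrite /Y /m -mulrA.
  under eq_bigr do rewrite -mulr_sumr.
  rewrite -mulr_sumr ler_wpM2l ?invr_ge0// (le_trans (quadratic_form_le _ _ _))//.
  by apply: ler_sum => s _; apply: ler_sum => t _; rewrite !mxE.
(* After passing to the pointwise majorant [Z], Minkowski is applied only to sums of the measurable
   [Y s t]. *)
apply: le_trans (Lnorm_mono P q0 (X := fun o => cmod _) (Y := Z) _) _.
  move=> o; rewrite !ger0_norm ?cmod_ge0//.
  by apply: sumr_ge0 => s _; apply: sumr_ge0 => t _; rewrite mulr_ge0.
apply: le_trans (Lnorm_sum_le _ (ltW q1) _ _) _.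
- by move=> s; exact: measurable_sum.
- by move=> s; apply: (Lnorm_sum_le _ (ltW q1) (mY s) (YS s)).
rewrite -(fineK Sf) -EFin_expe; under eq_bigr do under eq_bigr do rewrite -!EFinM.
under eq_bigr do rewrite sumEFin; rewrite sumEFin -EFinM lee_fin.
under eq_bigr do rewrite -mulr_suml; rewrite -mulr_suml -expr2 ler_wpM2r ?sqr_ge0//.
rewrite /m; under eq_bigr do rewrite -mulr_sumr.
by rewrite -mulr_sumr ler_wpM2l ?invr_ge0.
Qed.

(** * Uniform bounds on the inverse covariance matrix *)

Section Assembly.
Context {R : realType} (K : R) (f : R -> R) (c : int -> R) (F : canonical_factor R)
  (K1 : 1 < K) (fc : spectral_density f c) (fF : canonical_factorisation f F)
  (fd : bounded_away_from_zero f)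
  (cK : summable [set: int] (fun r : int => (`|r%:~R : R| `^ K * c r)%:E)).

Let a := phi_seq F.
Let s2 := sigma F ^- 2.

Lemma weight_le (j : nat) (k : R) : 0 <= k <= K -> j%:R `^ k <= 1 + j%:R `^ K :> R.
Proof.
move=> /andP[k0 kK]; case: j => [|j].
  rewrite ler_wpDr ?powR_ge0//; have [->|k0'] := eqVneq k 0; first by rewrite powRr0.
  by rewrite powR0.
by rewrite ler_wpDl// ler_powR// ler1n.
Qed.

Lemma normK_phi_ge k : 0 <= k <= K ->
  forall P, \sum_(j < P) (2 `^ k + j%:R `^ k) * `|a j| <= normK k (phi_coef F).
Proof.
move=> kK; have [A aA] := summable_phi fF; have [AK aK] := weighted_phi K1 fc fF cK.
apply: (@normK_causal _ _ _ ((2 `^ k + 1) * A + AK)); split => [j|P].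
  by rewrite mulr_ge0 ?addr_ge0 ?powR_ge0.
have h := lerD (ler_wpM2l (addr_ge0 (powR_ge0 2 k) ler01) (aA.2 P)) (aK.2 P).
apply: le_trans h; rewrite mulr_sumr -big_split; apply: ler_sum => j _ /=.
by rewrite -mulrDl ler_wpM2r// -addrA lerD2l weight_le.
Qed.

Lemma summable_phi_norm : summable_coefs a (normK 0 (phi_coef F)).
Proof.
split => // P; apply: le_trans (normK_phi_ge _ P); last by rewrite lexx (le_trans ler01 (ltW K1)).
by apply: ler_sum => j _; rewrite !powRr0 ler_peMl// ler_wpDl.
Qed.

(** Comes from a_0 = 1. Together with [normK_psi_ge1] it lets the smaller constant reached by the
    estimates be enlarged to [A_const]. *)
Lemma normK_ge1 : 1 <= normK 0 (phi_coef F).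
Proof.
apply: le_trans (summable_phi_norm.2 1%N).
by rewrite big_ord_recl big_ord0 addr0 normr1.
Qed.

Lemma normK_psi_ge1 : 1 <= normK 0 (psi_coef F).
Proof.
have [B bB] := summable_psi fF.
have h : bounded_sums (fun j : nat => (2 `^ 0 + j%:R `^ 0) * `|psi_seq F j|) (2 * B).
  split => [j|P]; first by rewrite mulr_ge0// addr_ge0// powR_ge0.
  under eq_bigr do rewrite !powRr0 (_ : 1 + 1 = 2%:R)//.
  by rewrite -mulr_sumr ler_wpM2l// bB.2.
apply: le_trans (normK_causal h 1); rewrite big_ord_recl big_ord0 addr0 normr1 !powRr0.
by rewrite mulr1 lerDl.
Qed.

Lemma sum_weighted1 n P : \sum_(n <= j < P) j%:R * `|a j| <= normK 1 (phi_coef F).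
Proof.
have k1 : 0 <= (1 : R) <= K by rewrite ler01 ltW.
apply: le_trans (normK_phi_ge k1 P).
rewrite (big_nat_widenl _ 0)//= big_mkcond/= big_mkord; apply: ler_sum => j _.
rewrite !powRr1//; case: ifP => _; last by rewrite mulr_ge0// addr_ge0.
by rewrite ler_wpM2r// lerDr.
Qed.

Lemma normK_phi_gt0 : 0 < normK K (phi_coef F).
Proof.
have KK : 0 <= K <= K by rewrite lexx (le_trans ler01 (ltW K1)).
apply: lt_le_trans (normK_phi_ge KK 1); rewrite big_ord_recl big_ord0 addr0 normr1 mulr1.
by rewrite ltr_wpDr ?powR_ge0// powR_gt0.
Qed.

Lemma rho_ge0 n : 0 <= rho n K F.
Proof. by apply: fine_ge0; apply: nneseries_ge0 => m _ _; rewrite lee_fin. Qed.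

(** For j > n, j = j^K / j^(K-1) <= j^K / n^(K-1): this is the origin of the rate n^(1-K). *)
Lemma sum_weighted_rho n P : (0 < n)%N ->
  \sum_(n.+1 <= j < P) j%:R * `|a j| <= rho n K F / n%:R `^ (K - 1).
Proof.
move=> n0; have [AK aK] := weighted_phi K1 fc fF cK; have K0 : 0 < K by exact: lt_trans K1.
have h : bounded_sums (fun j : nat => `|j%:R `^ K * ar F j|) AK.
  split => // N; apply: le_trans (aK.2 N); apply: ler_sum => -[[|j] _] _ /=.
    by rewrite powR0 ?gt_eqF// !mul0r normr0.
  by rewrite normrM ger0_norm ?powR_ge0// /phi_seq /= normrN.
have [_ hP _] := bounded_sums_series n.+1 h.
have nK : 0 < n%:R `^ (K - 1) :> R by rewrite powR_gt0// ltr0n.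
rewrite ler_pdivlMr// (le_trans _ (hP P))// mulr_suml; apply: ler_sum_nat => j /andP[nj _].
have j0 : (0 < j)%N by lia.
rewrite normrM ger0_norm ?powR_ge0// /a /phi_seq gtn_eqF// normrN mulrAC ler_wpM2r//.
rewrite -(@mulr_powRB1 _ j%:R K)// ler_wpM2l// ge0_ler_powR// ?nnegrE//.
  by rewrite subr_ge0 ltW.
by rewrite ler_nat; lia.
Qed.

(** Since 1/f = sigma^-2 conj(phi) phi, the symbol of column t is a character multiplied by two
    absolutely convergent series. *)
Lemma circulant_col n t : (0 < n)%N ->
  \sum_i cmod (circulant n (fun w => (f w)^-1) i t) <=
    s2 * normK 0 (phi_coef F) ^+ 2.
Proof.
move=> n0; have aA := summable_phi_norm.
have W : wiener n (fun w => conjc (fourier (causal a) w) * (fourier (causal a) w * chi t.+1%:Z w))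
    (normK 0 (phi_coef F) * (normK 0 (phi_coef F) * 1)).
  by apply: wiener_causalJ => //; apply: wiener_causal => //; exact: wiener_chi.
have := wiener_dft_norm W; rewrite mulr1 -expr2 => h.
apply: le_trans (ler_wpM2l (ltW (invsigma2_gt0 fF)) h).
rewrite -[sigma F ^- 2]gtr0_norm ?(invsigma2_gt0 fF)// -cmodR -dft_normZ.
apply: ler_sum => i _; rewrite le_eqVlt; apply/orP; left; apply/eqP; congr cmod.
rewrite /circulant (@adjoint_DFT_entry _ n n _ _ (chi t.+1%:Z)) => [|k]; last by rewrite mxE.
by apply: eq_avg => k kn; rewrite (invf_phi fF (frequency_itv kn)) -!mulrA.
Qed.

(* [G = L - E G] bounds the column sums of [G = Gamma^-1] by twice those of the
   approximate inverse [L] once [E] has norm at most 1/2; the finitely many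
   remaining [n] are absorbed in the constant. *)
Lemma inverse_row_bound : exists2 H, 0 <= H & forall n i, (0 < n)%N ->
  \sum_j cmod (map_mx (real_complex R) (invmx (Gamma n c)) i j) <= H.
Proof.
have aA := summable_phi_norm; have [M cM] := bounded_c K1 cK.
have [_ _ ceven fE] := fc; have [delta d0 hdelta] := fd.
set A := normK 0 (phi_coef F) in aA *.
pose S := normK 1 (phi_coef F).
have M0 := bounded_sums_ge0 cM; have A0 := bounded_sums_ge0 aA.
have wS : bounded_sums (fun j => j%:R * `|a j|) S.
  split => [j|P]; first by rewrite mulr_ge0.
  by rewrite -(big_mkord xpredT (fun j => j%:R * `|a j|)) sum_weighted1.
have S0 := bounded_sums_ge0 wS; have s20 := invsigma2_gt0 fF.
pose q := 2 * s2 * A * M.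
have q0 : 0 <= q by rewrite !mulr_ge0// ltW.
have e0 : 0 < (2 * (q + 1))^-1 by rewrite invr_gt0 mulr_gt0// ltr_wpDl.
have [N hN] := tail_small wS e0.
pose G n : 'M[R[i]]_n := map_mx (real_complex R) (invmx (Gamma n c)).
pose l := s2 * A ^+ 2 + 2 * s2 * A * S.
have l0 : 0 <= l by rewrite addr_ge0 ?mulr_ge0 ?sqr_ge0// ltW.
have T0 : 0 <= \sum_(m < N) mxnorm1 (G m) by apply: sumr_ge0 => m _; exact: mxnorm1_ge0.
exists (2 * l + \sum_(m < N) mxnorm1 (G m)); first by rewrite addr_ge0// mulr_ge0.
move=> n i n0; rewrite -/(G n).
have [nN|Nn] := ltnP n N.
  apply: ler_wpDl; first by rewrite mulr_ge0.
  rewrite (bigD1 (Ordinal nN))//= ler_wpDr//; last first.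
    exact: row_sum_le.
  by apply: sumr_ge0 => m _; exact: mxnorm1_ge0.
apply: ler_wpDr => //.
have Gu := Gamma_unit n d0 cM fE hdelta.
have Gsym k m : G n k m = G n m k.
  by rewrite !mxE -{1}(Gamma_sym n ceven) -trmx_inv mxE.
have tP P : \sum_(n.+1 <= j < P) j%:R * `|a j| <= tail (fun j => j%:R * `|a j|) n.
  have [nP|Pn] := leqP n.+1 P; last by rewrite big_geq ?(tail_ge0 _ wS)// ltnW.
  apply: le_trans (tail_ge wS (ltnW nP)); rewrite (sum_tail_le (fun j => j%:R * `|a j|) (ltnW nP)).
  by rewrite [leRHS]big_ltn// lerDr mulr_ge0.
have [E [LE En]] := approx_inverseP K1 fc fF cK n0 aA cM tP.
have E2 : mxnorm1 E <= 2^-1.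
  rewrite (le_trans En)// mulrA -/q.
  apply: le_trans (ler_pM q0 (tail_ge0 _ wS) (_ : q <= q + 1) (ltW (hN n Nn))) _.
    by rewrite lerDl.
  by rewrite invfM mulrCA mulfV ?mulr1// gt_eqF// ltr_wpDl.
have GE : G n = approx_inverse f F n - E *m G n by exact: inverse_split.
(* Symmetry of Gamma^-1 trades the row sum for a column sum, because E multiplies from the left in G
   = L - E G. *)
under eq_bigr do rewrite Gsym; set g := leLHS.
have : g <= l + 2^-1 * g.
  apply: le_trans (_ : \sum_k (cmod (approx_inverse f F n k i) + cmod ((E *m G n) k i)) <= _).
    apply: ler_sum => k _; rewrite [in X in cmod (X k i)]GE mxE [X in _ + X]mxE.
    by rewrite (le_trans (le_normcD _ _))// normcN.
  rewrite big_split lerD//=; last first.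
    rewrite (le_trans (col_sumM_le _ _ _))// ler_wpM2r// sumr_ge0// => *.
    exact: cmod_ge0.
  apply: le_trans (_ : \sum_k (cmod (circulant n (fun w => (f w)^-1) k i) +
     cmod ((adjoint (DFT n) *m Delta n (fun w => (f w)^-1) *m D_inf n F) k i)) <= _).
    by apply: ler_sum => k _; rewrite /approx_inverse mulmxDr mxE le_normcD.
  rewrite big_split lerD//=; first exact: circulant_col.
  apply: le_trans (D_inf_le K1 fc fF cK n0 aA (sum_weighted1 1)).
  exact: col_sum_le.
by lra.
Qed.

(** [H] is the constant in the bound on E times the uniform row bound of Gamma^-1, neither of which
    depends on n. The first term comes from D_oo alone. *)
Lemma inverse_close : exists2 H, 0 <= H & forall n, (0 < n)%N ->
  mxnorm1 (map_mx (real_complex R) (invmx (Gamma n c)) - circulant n (fun w => (f w)^-1)) <=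
    2 * s2 * normK 0 (phi_coef F) * normK 1 (phi_coef F) + H * (rho n K F / n%:R `^ (K - 1)).
Proof.
have aA := summable_phi_norm; have [M cM] := bounded_c K1 cK.
have [_ _ ceven fE] := fc; have [delta d0 hdelta] := fd.
have [H H0 HP] := inverse_row_bound; have s20 := invsigma2_gt0 fF.
have M0 := bounded_sums_ge0 cM; have A0 := bounded_sums_ge0 aA.
exists (2 * s2 * normK 0 (phi_coef F) * M * H); first by rewrite !mulr_ge0// ltW.
move=> n n0; set G := map_mx _ _; set C := circulant _ _.
have [E [LE En]] := approx_inverseP K1 fc fF cK n0 aA cM (fun P => sum_weighted_rho P n0).
have GE := inverse_split (Gamma_unit n d0 cM fE hdelta) LE.
have -> : G - C = adjoint (DFT n) *m Delta n (fun w => (f w)^-1) *m D_inf n F - E *m G.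
  by rewrite {1}/G GE /approx_inverse mulmxDr addrAC [X in X - _]addrAC subrr add0r.
rewrite (le_trans (mxnorm1B _ _))// lerD//.
  exact: (D_inf_le K1 fc fF cK n0 aA (sum_weighted1 1)).
rewrite (le_trans (mxnorm1M _ (fun i => HP n i n0)))//.
rewrite mulrAC ler_wpM2r// (le_trans En)// le_eqVlt; apply/orP; left; apply/eqP; rewrite /s2; ring.
Qed.

End Assembly.

Theorem theorem3p2 (R : realType) (K : R) (f : R -> R) (c : int -> R)
    (F : canonical_factor R) :
  1 < K ->
  spectral_density f c ->
  canonical_factorisation f F ->
  bounded_away_from_zero f ->
  summable [set: int] (fun r : int => (`|r%:~R : R| `^ K * c r)%:E) ->
  (forall n : nat, (0 < n)%N ->
     mxnorm1 (adjoint (DFT n) *m Delta n (fun w => (f w)^-1) *m D_inf n F)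
       <= A_const 1 F F) /\
  (exists eps : R, 0 < eps < 1 /\
     forall n : nat, (0 < n)%N ->
       let B := A_const 1 F F
                + C_const eps 0 F * rho n K F / n%:R `^ (K - 1)
                  * A_const K F F in
       mxnorm1 (map_mx (real_complex R) (invmx (Gamma n c))
                - circulant n (fun w => (f w)^-1)) <= B /\
       forall (d : measure_display) (T : measurableType d)
         (P : probability T R) (X : int -> {RV P >-> R}) (q : R),
         1 < q ->
         (sup_norm (2 * q) X < +oo)%E ->
         ('N[P]_(q%:E)[(fun o =>
            (cmod ((gaussian_likelihood c (sample X n o))%:C
                   - whittle_likelihood f (sample X n o)))%:E)]
          <= (n%:R^-1 * B)%:E * sup_norm (2 * q) X ^+ 2)%E).
Proof.
move=> K1 fc fF fd cK.
have A1 := normK_ge1 K1 fc fF cK; have B1 := normK_psi_ge1 fF.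
have K0 := normK_phi_gt0 K1 fc fF cK; have s20 := invsigma2_gt0 fF.
have aA := summable_phi_norm K1 fc fF cK.
set A := normK 0 (phi_coef F) in A1 aA; set B := normK 0 (psi_coef F) in B1.
have A0 : 0 < A by exact: lt_le_trans A1.
have B0 : 0 < B by exact: lt_le_trans B1.
pose S := normK 1 (phi_coef F).
have S0 : 0 <= S by have := sum_weighted1 K1 fc fF cK 1 0; rewrite big_geq.
(* [A_const] contains the extra factor A * B, and both A and B are at least 1. *)
have slack : 2 * sigma F ^- 2 * A * S <= A_const 1 F F.
  rewrite /A_const -/A -/B -/S ler_wpM2r//.
  rewrite -[leRHS]mulrA ler_pM2l ?mulr_gt0// expr2 mulrA.
  by rewrite ler_peMl ?(ltW A0)// mulr_ege1.
split=> [n n0|].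
  exact: le_trans (D_inf_le K1 fc fF cK n0 aA (sum_weighted1 K1 fc fF cK 1)) slack.
have [H H0 hH] := inverse_close K1 fc fF fd cK.
pose D := A ^+ 2 * B ^+ 2 * A_const K F F.
have D0 : 0 < D.
  by rewrite /D /A_const !mulr_gt0 ?exprn_gt0// -/A -/B.
(* With 1 - eps = 1/y, the fraction (3 - eps) / (1 - eps) is 2 y + 1, so the second term of the
   bound is (2 y + 1) D times the rate. Any y > 1 with (2 y + 1) D >= H would do; the summand 2
   keeps eps in (0, 1). *)
pose y := 2 + H / D.
have HD : 0 <= H / D by rewrite divr_ge0// ltW.
have y0 : 1 < y by rewrite /y; lra.
have y0' : 0 < y by exact: lt_trans y0.
exists (1 - y^-1); split.
  by rewrite subr_gt0 invf_lt1// y0 gtrBl invr_gt0.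
move=> n n0 Bd.
have VB : mxnorm1 (map_mx (real_complex R) (invmx (Gamma n c))
    - circulant n (fun w => (f w)^-1)) <= Bd.
  rewrite (le_trans (hH n n0))// /Bd lerD//.
  have -> : C_const (1 - y^-1) 0 F * rho n K F / n%:R `^ (K - 1) * A_const K F F =
      (2 * y + 1) * D * (rho n K F / n%:R `^ (K - 1)).
    have -> : C_const (1 - y^-1) 0 F = (2 * y + 1) * (A ^+ 2 * B ^+ 2).
      have E : 1 - (1 - y^-1) = y^-1 by ring.
      by rewrite /C_const -/A -/B E; field; rewrite gt_eqF.
    by rewrite /D; ring.
  rewrite ler_wpM2r ?divr_ge0 ?powR_ge0 ?rho_ge0//.
  rewrite -ler_pdivrMr//; rewrite /y; lra.
split=> // d T P X q q1 Sfin; exact: likelihood_Lnorm.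
Qed.
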